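(* Under vanishing, reflective or periodic boundary conditions, the 1D PCP central DG methods are $L^1$-stable in the sense that $$\big\|\tilde{\mathbf U}_h^I(t_n,x)\big\|_{L^1}+\big\|\tilde{\mathbf U}_h^J(t_n,x)\big\|_{L^1}<2\Big(\big\|\mathbf U_h^I(0,x)\big\|_{L^1}+\big\|\mathbf U_h^J(0,x)\big\|_{L^1}\Big)$$ for every time level $t_n$, where $\tilde{\mathbf U}_h^I,\tilde{\mathbf U}_h^J$ are the limited numerical solutions, $\mathbf U_h^I(0,x),\mathbf U_h^J(0,x)$ are the initial DG approximations, and $\|\cdot\|_{L^1}$ is the discrete norm $$\|\mathbf w^I\|_{L^1}:=\frac{\Delta x}2\sum_j\sum_{\alpha=1}^L\hat\omega_\alpha\Big(\big\|\mathbf w_j^I(\hat x_{j-\frac14}^\alpha)\big\|_{l^1}+\big\|\mathbf w_j^I(\hat x_{j+\frac14}^\alpha)\big\|_{l^1}\Big),$$ $$\|\mathbf w^J\|_{L^1}:=\frac{\Delta x}2\sum_j\sum_{\alpha=1}^L\hat\omega_\alpha\Big(\big\|\mathbf w_{j+\frac12}^J(\hat x_{j+\frac14}^\alpha)\big\|_{l^1}+\big\|\mathbf w_{j+\frac12}^J(\hat x_{j+\frac34}^\alpha)\big\|_{l^1}\Big).$$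
   Context: **Equations.** Units with speed of light $c=1$; dimension $d=1$. The equation of state is a function $e=e(p,\rho)$ of pressure $p>0$ and rest-mass density $\rho>0$; $h(p,\rho)=1+e(p,\rho)+p/\rho$. To primitive variables $(\rho,v_1,p)$ with $|v_1|<1$, $W=(1-v_1^2)^{-1/2}$, corresponds $\mathbf U=(D,m_1,E)^{\rm T}\in\mathbb R^3$, $D=\rho W$, $m_1=\rho hW^2v_1$, $E=\rho hW^2-p$. The admissible set $\mathcal G$ is the set of $\mathbf U$ whose primitive variables satisfy $\rho>0,p>0,e>0,|v_1|<1$; that is, there is exactly one triple $(\rho,v_1,p)$ with $\rho>0$, $|v_1|<1$, $p>0$ satisfying the three relations, and $e(p,\rho)>0$ for it. For $\mathbf U\in\mathcal G$, $\mathbf F_1(\mathbf U)=(Dv_1,v_1m_1+p,m_1)^{\rm T}$. Put $q(\mathbf U)=E-\sqrt{D^2+m_1^2}$. $\|\cdot\|_{l^1}$ is the $l^1$ norm on $\mathbb R^3$. Standing assumptions on the equation of state: $e$ is continuously differentiable on $\mathbb R^+\times\mathbb R^+$; for all $p,\rho>0$, $h\ge\sqrt{1+p^2/\rho^2}+p/\rho$ and $h\big(\frac1\rho-\frac{\partial h}{\partial p}\big)<\frac{\partial h}{\partial\rho}<0$; for every fixed $\rho>0$, $\lim_{p\to0^+}e(p,\rho)=0$, $\lim_{p\to+\infty}e(p,\rho)=+\infty$. **Meshes and spaces.** $I_j=(x_{j-\frac12},x_{j+\frac12})$, uniform with step $\Delta x$ and centers $x_j$; dual cells $J_{j+\frac12}=(x_j,x_{j+1})$;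 $x_{j\pm\frac14}=x_j\pm\frac{\Delta x}4$, $x_{j+\frac34}=x_{j+1}-\frac{\Delta x}4$. $\mathbf U_h^I,\mathbf U_h^J$ are piecewise polynomial vector functions of degree at most $K$ on $\{I_j\}$, $\{J_{j+\frac12}\}$; subscripts $j$, $j+\frac12$ denote restriction to the cell. On each half cell $[x_{j\pm\frac14}-\frac{\Delta x}4,x_{j\pm\frac14}+\frac{\Delta x}4]$, let $\{x_{j\pm\frac14}^\alpha\}_{\alpha=1}^Q$ be the Gauss nodes with weights $\omega_\alpha>0$, $\sum\omega_\alpha=1$, $Q\ge K+1$, and $\{\hat x_{j\pm\frac14}^\alpha\}_{\alpha=1}^L$ the Gauss–Lobatto nodes with weights $\hat\omega_\alpha>0$, $\sum\hat\omega_\alpha=1$, $L>(K+3)/2$. **Semi-discrete operator.** With a constant $\tau_{\max}>0$, $\mathscr L(\mathbf U)$ for $\mathbf U=(\mathbf U_h^I,\mathbf U_h^J)$ is the pair $(\mathbf R^I,\mathbf R^J)$ of piecewise polynomials of degree at most $K$ on the two meshes such that for every $j$ and every polynomial $w$ of degree at most $K$, $$\int_{I_j}\mathbf R^Iw\,dx=\frac1{\tau_{\max}}\int_{I_j}(\mathbf U_h^J-\mathbf U_h^I)w\,dx+\frac{\Delta x}2\sum_{\alpha=1}^Q\omega_\alpha\Big(\mathbf F_1(\mathbf U_h^J(x_{j-\frac14}^\alpha))w'(x_{j-\frac14}^\alpha)+\mathbf F_1(\mathbf U_h^J(x_{j+\frac14}^\alpha))w'(x_{j+\frac14}^\alpha)\Big)$$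 $$\qquad+\mathbf F_1(\mathbf U_h^J(x_{j-\frac12}))w(x_{j-\frac12})-\mathbf F_1(\mathbf U_h^J(x_{j+\frac12}))w(x_{j+\frac12}),$$ and the same identity with $I$ and $J$ exchanged and $j$ replaced by $j+\frac12$ for $\mathbf R^J$ on $J_{j+\frac12}$. **PCP limiter.** Let a cell have solution polynomial $(D(x),m(x),E(x))^{\rm T}$ with average $\overline{\mathbf U}=(\overline D,\overline m,\overline E)^{\rm T}\in\mathcal G$; let $\mathcal S$ be the set of all Gauss and Gauss–Lobatto nodes in the two halves of the cell, and let $\epsilon>0$ be a sufficiently small number such that $\overline D\ge\epsilon$, $q(\overline{\mathbf U})\ge\epsilon$. Step (i): with $D_{\min}=\min_{\mathcal S}D$, put $\hat D=\theta_1(D-\overline D)+\overline D$ with $\theta_1=(\overline D-\epsilon)/(\overline D-D_{\min})$ if $D_{\min}<\epsilon$, $\hat D=D$ otherwise; $\hat{\mathbf U}=(\hat D,m,E)^{\rm T}$. Step (ii): with $q_{\min}=\min_{\mathcal S}q(\hat{\mathbf U}(x))$, put $\tilde{\mathbf U}=\theta_2(\hat{\mathbf U}-\overline{\mathbf U})+\overline{\mathbf U}$ with $\theta_2=(q(\overline{\mathbf U})-\epsilon)/(q(\overline{\mathbf U})-q_{\min})$ if $q_{\min}<\epsilon$, $\tilde{\mathbf U}=\hat{\mathbf U}$ otherwise. The limited polynomial is $\tilde{\mathbf U}$; a tilde denotes limited quantities. It is applied separately to every cell of both meshes. **PCP central DG methods.** The initial DG approximations have all cell averages in $\mathcal G$.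 Time stepping is either by the SSP Runge–Kutta method $$\mathbf U^*=\mathbf U^n+\Delta t\mathscr L(\mathbf U^n),\quad\mathbf U^{**}=\tfrac34\mathbf U^n+\tfrac14(\mathbf U^*+\Delta t\mathscr L(\mathbf U^* )),\quad\mathbf U^{n+1}=\tfrac13\mathbf U^n+\tfrac23(\mathbf U^{**}+\Delta t\mathscr L(\mathbf U^{**}))$$ with $0<\Delta t\le\hat\omega_1\theta\Delta x/(2c)$, $\theta=\Delta t/\tau_{\max}\in(0,1]$, or by the SSP multi-step method $$\mathbf U^{n+1}=\tfrac{16}{27}(\mathbf U^n+3\Delta t\mathscr L(\mathbf U^n))+\tfrac{11}{27}\big(\mathbf U^{n-3}+\tfrac{12}{11}\Delta t\mathscr L(\mathbf U^{n-3})\big)$$ with $0<\Delta t\le\hat\omega_1\theta\Delta x/(2c)$, $\theta=\Delta t/\tau_{\max}\in(0,\frac13]$ (its starting levels $t_1,t_2,t_3$ being produced by the Runge–Kutta method). In both, $\mathbf U^n,\mathbf U^*,\mathbf U^{**},\mathbf U^{n-3}$ on the right-hand sides are replaced by their limited versions. **Boundary conditions.** Periodic: the solution is periodic with period the length of $\Omega=(x_{\frac12},x_{N+\frac12})$. Reflective: the solution is extended beyond each end point of $\Omega$ by reflection about it, $D,E$ being even and $m_1$ odd. Vanishing: the mesh is the whole line, the discrete norms are finite and the solution tends to $0$ as $|x|\to\infty$. In the discrete norms the sums run over the half cells contained in $\Omega$ (in the whole line, in the vanishing case). *)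

(* Defs.v *)
From mathcomp Require Import all_boot all_order all_algebra.
From mathcomp Require Import all_classical all_reals all_analysis.

Set Implicit Arguments.
Unset Strict Implicit.
Unset Printing Implicit Defensive.

Import Order.TTheory GRing.Theory Num.Theory.
Import numFieldNormedType.Exports.

Local Open Scope classical_set_scope.
Local Open Scope ring_scope.

(* A state (D, m_1, E) is a triple of reals; a solution polynomial on a cell is
   a triple of polynomials in the global coordinate x. *)
Notation state R := (R * R * R)%type.
Notation pstate R := ({poly R} * {poly R} * {poly R})%type.

Definition map3 (A B : Type) (f : A -> B) (u : A * A * A) : B * B * B :=
  (f u.1.1, f u.1.2, f u.2).

Definition evalp (R : realType) (U : pstate R) (x : R) : state R :=
  map3 (fun f : {poly R} => f.[x]) U.

Definition constp (R : realType) (u : state R) : pstate R :=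
  map3 (fun a : R => a%:P) u.

(* The speed of light is 1. As in e(p, rho), the pressure is the first
   argument. *)
Definition enthalpy (R : realType) (e : R -> R -> R) (p rho : R) : R :=
  1 + e p rho + p / rho.

Definition dp (R : realType) (f : R -> R -> R) (p rho : R) : R :=
  derive1 (fun p' : R => f p' rho) p.
Definition drho (R : realType) (f : R -> R -> R) (p rho : R) : R :=
  derive1 (fun rho' : R => f p rho') rho.

Definition C1_on_positive_quadrant (R : realType) (f : R -> R -> R) : Prop :=
  forall p rho : R, 0 < p -> 0 < rho ->
    [/\ derivable (fun p' => f p' rho) p 1,
        derivable (fun rho' => f p rho') rho 1,
        {for (p, rho), continuous (fun z : R * R => dp f z.1 z.2)} &
        {for (p, rho), continuous (fun z : R * R => drho f z.1 z.2)}].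

Definition eos_assumptions (R : realType) (e : R -> R -> R) : Prop :=
  let h := enthalpy e in
  [/\ C1_on_positive_quadrant e,
      forall p rho : R, 0 < p -> 0 < rho ->
        Num.sqrt (1 + p ^+ 2 / rho ^+ 2) + p / rho <= h p rho,
      forall p rho : R, 0 < p -> 0 < rho ->
        h p rho * (1 / rho - dp h p rho) < drho h p rho
        /\ drho h p rho < 0,
      forall rho : R, 0 < rho -> e p rho @[p --> 0^'+] --> 0 &
      forall rho : R, 0 < rho -> e p rho @[p --> +oo] --> +oo].

Definition lorentz (R : realType) (v : R) : R := (Num.sqrt (1 - v ^+ 2))^-1.

(* (rho, v, p) are physical primitive variables of U. *)
Definition is_primitive (R : realType) (e : R -> R -> R) (U : state R)
    (t : R * R * R) : Prop :=
  let: (rho, v, p) := t in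
  let W := lorentz v in
  let h := enthalpy e p rho in
  [/\ 0 < rho, `|v| < 1, 0 < p &
      U = (rho * W, rho * h * W ^+ 2 * v, rho * h * W ^+ 2 - p)].

Definition admissible (R : realType) (e : R -> R -> R) (U : state R) : Prop :=
  exists rho v p : R,
    [/\ is_primitive e U (rho, v, p),
        forall t, is_primitive e U t -> t = (rho, v, p) & 0 < e p rho].

(* The default triple (1, 0, 1) is only returned when U has no physical
   primitive variables, in particular never for an admissible U. *)
Definition primitive (R : realType) (e : R -> R -> R) (U : state R)
    : R * R * R :=
  xget (1, 0, 1) [set t | is_primitive e U t].

Definition flux (R : realType) (e : R -> R -> R) (U : state R) : state R :=
  let: (D, m, E) := U in
  let: (rho, v, p) := primitive e U in
  (D * v, v * m + p, m).

Definition qfun (R : realType) (U : state R) : R :=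
  let: (D, m, E) := U in E - Num.sqrt (D ^+ 2 + m ^+ 2).

Definition l1norm (R : realType) (U : state R) : R :=
  let: (D, m, E) := U in `|D| + `|m| + `|E|.

(* Nodes in [-1, 1]; the indices run over 0, ..., npts - 1, so that alpha is
   shifted by one. *)
Record quadrature (R : realType) := Quadrature {
  npts : nat;
  node : nat -> R;
  weight : nat -> R
}.

(* Nodes are listed in increasing order, the weights are normalized to have
   sum 1, and the rule reproduces the mean value over [-1, 1] of every
   polynomial of degree < d. *)
Definition is_quadrature (R : realType) (r : quadrature R) (d : nat) : Prop :=
  [/\ forall a b : nat, (a < b < npts r)%N -> node r a < node r b,
      forall a : nat, (a < npts r)%N -> -1 <= node r a <= 1,
      forall a : nat, (a < npts r)%N -> 0 < weight r a,
      \sum_(a < npts r) weight r a = 1 &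
      forall f : {poly R}, (size f <= d)%N ->
        \sum_(a < npts r) weight r a * f.[node r a] =
        2^-1 * \int[lebesgue_measure]_(x in `[(-1 : R), 1]) f.[x]].

(* The rule with Q nodes that is exact up to degree 2Q - 1. *)
Definition is_gauss (R : realType) (r : quadrature R) : Prop :=
  (0 < npts r)%N /\ is_quadrature r (2 * npts r).

(* The rule with L nodes, containing both end points, that is exact up to
   degree 2L - 3. *)
Definition is_gauss_lobatto (R : realType) (r : quadrature R) : Prop :=
  [/\ (1 < npts r)%N, node r 0%N = -1, node r (npts r).-1 = 1 &
      is_quadrature r (2 * npts r - 2)].

Record cdg (R : realType) := Cdg {
  eos : R -> R -> R;
  dx : R;
  x0 : R;                  (* center of I_0 *)
  ncells : nat;            (* N, with Omega = (x_{1/2}, x_{N+1/2}) *)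
  deg : nat;               (* K *)
  gauss : quadrature R;
  lobatto : quadrature R;
  tau : R;                 (* tau_max *)
  dt : R
}.

(* The centers of I_j and of J_{j+1/2}. *)
Definition ctrI (R : realType) (s : cdg R) (j : int) : R := x0 s + j%:~R * dx s.
Definition ctrJ (R : realType) (s : cdg R) (j : int) : R :=
  ctrI s j + dx s / 2.

(* Piecewise polynomial functions on the two meshes: the first component at j
   is the restriction to I_j, the second one is the restriction to J_{j+1/2}. *)
Notation csol R := ((int -> pstate R) * (int -> pstate R))%type.

(* The image of the a-th node of r in the half cell with midpoint y. *)
Definition halfnode (R : realType) (s : cdg R) (r : quadrature R) (y : R)
    (a : nat) : R :=
  y + dx s / 4 * node r a.

Definition vint (R : realType) (a b : R) (U : pstate R) (w : {poly R})
    : state R :=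
  map3 (fun f : {poly R} =>
    \int[lebesgue_measure]_(x in `[a, b]) (f.[x] * w.[x])) U.

(* The average over the cell with center c. *)
Definition average (R : realType) (s : cdg R) (c : R) (U : pstate R)
    : state R :=
  (dx s)^-1 *: vint (c - dx s / 2) (c + dx s / 2) U 1.

(* The weak form on the cell with center c and solution U; Ul and Ur are the
   solution polynomials of the two cells of the other mesh that cover the left
   and the right half of this cell. *)
Definition cell_weak_form (R : realType) (s : cdg R) (c : R)
    (U Ul Ur : pstate R) (Rc : pstate R) : Prop :=
  let F u := flux (eos s) u in
  let xl := halfnode s (gauss s) (c - dx s / 4) in
  let xr := halfnode s (gauss s) (c + dx s / 4) in
  let cl := c - dx s / 2 in
  let cr := c + dx s / 2 in
  forall w : {poly R}, (size w <= (deg s).+1)%N ->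
    vint cl cr Rc w =
      (tau s)^-1 *: (vint cl c (Ul - U) w + vint c cr (Ur - U) w)
    + (dx s / 2) *: \sum_(a < npts (gauss s)) weight (gauss s) a *:
        (w^`().[xl a] *: F (evalp Ul (xl a))
         + w^`().[xr a] *: F (evalp Ur (xr a)))
    + w.[cl] *: F (evalp Ul cl) - w.[cr] *: F (evalp Ur cr).

Definition degree_le (R : realType) (K : nat) (U : pstate R) : Prop :=
  [/\ (size U.1.1 <= K.+1)%N, (size U.1.2 <= K.+1)%N & (size U.2 <= K.+1)%N].

Definition is_cdg_operator (R : realType) (s : cdg R) (U LU : csol R) : Prop :=
  forall j : int,
    [/\ degree_le (deg s) (LU.1 j),
        degree_le (deg s) (LU.2 j),
        cell_weak_form s (ctrI s j) (U.1 j) (U.2 (j - 1)) (U.2 j) (LU.1 j) &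
        cell_weak_form s (ctrJ s j) (U.2 j) (U.1 j) (U.1 (j + 1)) (LU.2 j)].

Definition cell_nodes (R : realType) (s : cdg R) (c : R) : seq R :=
  [seq halfnode s (gauss s) (c - dx s / 4) a | a <- iota 0 (npts (gauss s))] ++
  [seq halfnode s (gauss s) (c + dx s / 4) a | a <- iota 0 (npts (gauss s))] ++
  [seq halfnode s (lobatto s) (c - dx s / 4) a
     | a <- iota 0 (npts (lobatto s))] ++
  [seq halfnode s (lobatto s) (c + dx s / 4) a
     | a <- iota 0 (npts (lobatto s))].

(* The center c, an end point of both halves, is itself a Gauss-Lobatto node,
   so that starting the minimum from f c is harmless. *)
Definition node_min (R : realType) (s : cdg R) (c : R) (f : R -> R) : R :=
  \big[Num.min/f c]_(x <- cell_nodes s c) f x.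

Definition pcp_limiter (R : realType) (s : cdg R) (eps c : R) (U : pstate R)
    : pstate R :=
  let Ub := average s c U in
  let: (D, m, E) := U in
  let: (Db, mb, Eb) := Ub in
  let Dmin := node_min s c (fun x => D.[x]) in
  let theta1 := (Db - eps) / (Db - Dmin) in
  let Dh := if Dmin < eps then theta1 *: (D - Db%:P) + Db%:P else D in
  let Uh : pstate R := (Dh, m, E) in
  let qmin := node_min s c (fun x => qfun (evalp Uh x)) in
  let theta2 := (qfun Ub - eps) / (qfun Ub - qmin) in
  if qmin < eps then theta2 *: (Uh - constp Ub) + constp Ub else Uh.

(* Ut is obtained by limiting U in the cell with center c. The limiter is only
   specified for an admissible average; eps may depend on the cell. *)
Definition cell_limited (R : realType) (s : cdg R) (c : R) (U Ut : pstate R)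
    : Prop :=
  admissible (eos s) (average s c U) ->
  exists eps : R,
    [/\ 0 < eps, eps <= (average s c U).1.1, eps <= qfun (average s c U) &
        Ut = pcp_limiter s eps c U].

Definition limited (R : realType) (s : cdg R) (U Ut : csol R) : Prop :=
  forall j : int, cell_limited s (ctrI s j) (U.1 j) (Ut.1 j) /\
                  cell_limited s (ctrJ s j) (U.2 j) (Ut.2 j).

Inductive boundary := Periodic | Reflective | Vanishing.

(* x_{1/2} and x_{N+1/2} are the centers of J_{1/2} and J_{N+1/2}. *)
Definition omega (R : realType) (s : cdg R) (bc : boundary) : set R :=
  match bc with
  | Vanishing => setT
  | _ => `]ctrJ s 0, ctrJ s (ncells s)%:Z[
  end.

(* The part of the discrete norm belonging to the half cell with midpoint y. *)
Definition half_norm (R : realType) (s : cdg R) (y : R) (U : pstate R) : R :=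
  \sum_(a < npts (lobatto s))
     weight (lobatto s) a * l1norm (evalp U (halfnode s (lobatto s) y a)).

Definition half_cell (R : realType) (s : cdg R) (y : R) : set R :=
  `]y - dx s / 4, y + dx s / 4[.

Definition mesh_norm (R : realType) (s : cdg R) (Om : set R) (ctr : int -> R)
    (w : int -> pstate R) : \bar R :=
  ((dx s / 2)%:E *
   (\esum_(j in [set j : int | half_cell s (ctr j - dx s / 4) `<=` Om])
       (half_norm s (ctr j - dx s / 4) (w j))%:E
    + \esum_(j in [set j : int | half_cell s (ctr j + dx s / 4) `<=` Om])
       (half_norm s (ctr j + dx s / 4) (w j))%:E))%E.

Definition normI (R : realType) (s : cdg R) (bc : boundary) (U : csol R)
    : \bar R := mesh_norm s (omega s bc) (ctrI s) U.1.
Definition normJ (R : realType) (s : cdg R) (bc : boundary) (U : csol R)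
    : \bar R := mesh_norm s (omega s bc) (ctrJ s) U.2.

Definition periodic_solution (R : realType) (s : cdg R) (U : csol R) : Prop :=
  let N : int := (ncells s)%:Z in
  forall (j : int) (x : R),
    evalp (U.1 (j + N)) (x + N%:~R * dx s) = evalp (U.1 j) x /\
    evalp (U.2 (j + N)) (x + N%:~R * dx s) = evalp (U.2 j) x.

Definition mirror (R : realType) (u : state R) : state R :=
  let: (D, m, E) := u in (D, - m, E).

(* Reflection about x_{M+1/2} maps I_j onto I_{2M+1-j} and J_{j+1/2} onto
   J_{2M-j+1/2}. *)
Definition reflected_about (R : realType) (s : cdg R) (M : int) (U : csol R)
    : Prop :=
  forall (j : int) (x : R),
    evalp (U.1 (2 * M + 1 - j)) (2 * ctrJ s M - x) = mirror (evalp (U.1 j) x) /\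
    evalp (U.2 (2 * M - j)) (2 * ctrJ s M - x) = mirror (evalp (U.2 j) x).

Definition cell (R : realType) (s : cdg R) (c : R) : set R :=
  `]c - dx s / 2, c + dx s / 2[.

Definition tends_to_zero (R : realType) (s : cdg R) (ctr : int -> R)
    (w : int -> pstate R) : Prop :=
  forall eta : R, 0 < eta -> exists X : R, forall (j : int) (x : R),
    cell s (ctr j) x -> X <= `|x| -> l1norm (evalp (w j) x) < eta.

Definition boundary_condition (R : realType) (s : cdg R) (bc : boundary)
    (U : csol R) : Prop :=
  match bc with
  | Periodic => periodic_solution s U
  | Reflective => reflected_about s 0 U /\ reflected_about s (ncells s)%:Z U
  | Vanishing =>
      [/\ (normI s Vanishing U < +oo)%E, (normJ s Vanishing U < +oo)%E,
          tends_to_zero s (ctrI s) U.1 & tends_to_zero s (ctrJ s) U.2]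
  end.

(* U is an approximation subject to the boundary condition, and so is its
   limited version Ut. *)
Definition limited_bc (R : realType) (s : cdg R) (bc : boundary)
    (U Ut : csol R) : Prop :=
  [/\ limited s U Ut, boundary_condition s bc U & boundary_condition s bc Ut].

(* One Runge-Kutta step from the limited solution Un to the not yet limited
   solution U'. *)
Definition rk_step (R : realType) (s : cdg R) (bc : boundary)
    (Un U' : csol R) : Prop :=
  exists L0 U1 U1t L1 U2 U2t L2 : csol R,
    [/\ is_cdg_operator s Un L0,
        U1 = Un + dt s *: L0 &
        limited_bc s bc U1 U1t] /\
    [/\ is_cdg_operator s U1t L1,
        U2 = (3 / 4) *: Un + (1 / 4) *: (U1t + dt s *: L1) &
        limited_bc s bc U2 U2t] /\
    is_cdg_operator s U2t L2 /\
    U' = (1 / 3) *: Un + (2 / 3) *: (U2t + dt s *: L2).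

(* One multi-step step from the limited solutions Un and Un3 at the levels n
   and n - 3. *)
Definition ms_step (R : realType) (s : cdg R) (Un Un3 U' : csol R) : Prop :=
  exists L0 L3 : csol R,
    [/\ is_cdg_operator s Un L0,
        is_cdg_operator s Un3 L3 &
        U' = (16 / 27) *: (Un + (3 * dt s) *: L0)
           + (11 / 27) *: (Un3 + (12 / 11 * dt s) *: L3)].

Inductive ssp_method := RungeKutta | MultiStep.

Definition time_step (R : realType) (s : cdg R) (bc : boundary)
    (meth : ssp_method) (Ut : nat -> csol R) (n : nat) (U' : csol R) : Prop :=
  match meth with
  | RungeKutta => rk_step s bc (Ut n) U'
  | MultiStep => if (n < 3)%N then rk_step s bc (Ut n) U'
                 else ms_step s (Ut n) (Ut (n - 3)%N) U'
  end.

Definition theta (R : realType) (s : cdg R) : R := dt s / tau s.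

Definition theta_bound (R : realType) (meth : ssp_method) : R :=
  match meth with RungeKutta => 1 | MultiStep => 1 / 3 end.

Definition time_step_restriction (R : realType) (s : cdg R)
    (meth : ssp_method) : Prop :=
  [/\ 0 < dt s, dt s <= weight (lobatto s) 0%N * theta s * dx s / 2 &
      0 < theta s <= theta_bound R meth].

Definition initial_approximation (R : realType) (s : cdg R) (U : csol R)
    : Prop :=
  forall j : int,
    [/\ degree_le (deg s) (U.1 j),
        degree_le (deg s) (U.2 j),
        admissible (eos s) (average s (ctrI s j) (U.1 j)) &
        admissible (eos s) (average s (ctrJ s j) (U.2 j))].

(* U n and Ut n are the numerical solution at the time level t_n before and
   after limiting. *)
Definition pcp_cdg_solution (R : realType) (s : cdg R) (bc : boundary)
    (meth : ssp_method) (U Ut : nat -> csol R) : Prop :=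
  [/\ initial_approximation s (U 0%N),
      forall n : nat, limited_bc s bc (U n) (Ut n) &
      forall n : nat, time_step s bc meth Ut n (U n.+1)].

Definition cdg_valid (R : realType) (s : cdg R) : Prop :=
  [/\ 0 < dx s, 0 < tau s & (0 < ncells s)%N] /\
  [/\ is_gauss (gauss s), is_gauss_lobatto (lobatto s),
      (deg s + 1 <= npts (gauss s))%N &
      (deg s + 3 < 2 * npts (lobatto s))%N].

(* Main.v *)
Require Import Defs.
From mathcomp Require Import all_boot all_order all_algebra.
From mathcomp Require Import all_classical all_reals all_analysis.
From mathcomp Require Import zify ring lra.

Set Implicit Arguments.
Unset Strict Implicit.
Unset Printing Implicit Defensive.

Import Order.TTheory GRing.Theory Num.Theory.
Import numFieldNormedType.Exports.

Local Open Scope classical_set_scope.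
Local Open Scope ring_scope.

(** The conserved quantity behind the estimate is the sum [D + E] of the mass
    and the energy.  For a physical state ([D > 0] and
    [E > sqrt (D^2 + m^2)]) one has [|m| < E], so that the l1 norm
    [D + |m| + E] stays below [2 (D + E) - D].  If the limited solution is
    physical at all Gauss-Lobatto nodes, summing this inequality with the
    quadrature weights bounds its discrete norm strictly by twice the total of
    [D + E]; the quadrature is exact, so this total only sees cell averages.
    It is conserved by the scheme and preserved by the limiter, and at the
    initial time it is at most the discrete norm of the initial data.

    What remains is to show that the limited solution is always physical.
    The physical states form the intersection of the open half spaces
    [0 < lin c u], where [c] is [(1, 0, 0)] or [(a, b, 1)] with
    [a^2 + b^2 <= 1] ([physicalP]); everything about averages, convex
    combinations and Euler steps can therefore be checked on one scalar
    polynomial [linp c P] at a time.  The hypotheses on the equation of state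
    enter in three places.  The lower bound on the enthalpy gives
    [0 <= lin c (u + F u)] and [0 <= lin c (u - F u)] for admissible [u]
    ([lin_flux_ge0]), so that a numerical flux at a cell end is dominated by
    the value at the quadrature node sitting there; this is where the
    restriction on the time step is used ([euler_cell_physical]).  The same
    bound shows that admissible states are physical.  Conversely, a physical
    state has exactly one pressure ([physical_admissible]): the pressures are
    the zeros of a function that is positive near 0, negative far away, and
    has, by the bound on the sound speed, a negative derivative at each zero.

    For conservation ([total_conserved]), the update of the averages is
    written as an identity between nonnegative sequences in which the fluxes
    telescope, and summed over a set of indices invariant under translation.
    The periodic and the vanishing case provide such a set directly.  A
    solution that is reflected about both end points is periodic with twice
    the length of the domain, and its sums over that period are twice those
    over the domain ([domain_sum_period]). *)

(** * Calculus of one and two variables *)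

Section Calculus.
Variable R : realType.
Implicit Types (f r : R -> R) (x l a b : R).

Lemma is_derive_epsP f x l :
  is_derive x 1 f l <->
  forall eps, 0 < eps -> exists2 d, 0 < d &
    forall h, h != 0 -> `|h| < d -> `|l - h^-1 * (f (h + x) - f x)| < eps.
Proof.
split=> [df eps eps0|H].
  have /cvgrPdist_lt/(_ eps eps0) : h^-1 *: ((f \o shift x) (h *: 1) - f x) @[h --> 0^'] --> l.
    by have := @ex_derive _ _ _ _ _ _ _ df; rewrite -(@derive_val _ _ _ _ _ _ _ df).
  rewrite near_withinE /= => /nbhs_ballP[d /= d0 dP]; exists d => // h h0 hd.
  have := dP h; rewrite /ball /= sub0r normrN => /(_ hd h0) /=.
  by rewrite /= /shift /GRing.scale /= mulr1.
have cv : h^-1 *: ((f \o shift x) (h *: 1) - f x) @[h --> 0^'] --> l.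
  apply/cvgrPdist_lt => eps eps0; rewrite near_withinE /=.
  have [d d0 dP] := H eps eps0.
  apply/nbhs_ballP; exists d => //= h; rewrite /ball /= sub0r normrN => hd h0.
  by rewrite /shift /GRing.scale /= mulr1; exact: dP.
apply: DeriveDef; first by apply/cvg_ex; exists l.
by apply/cvg_lim.
Qed.

Lemma derivable_is_derive1 f x :
  derivable f x 1 -> is_derive x 1 f (derive1 f x).
Proof. by move=> d; apply: DeriveDef; rewrite ?derive1E. Qed.

(** The graph crosses zero from above wherever it vanishes with negative
    slope. *)
Lemma derive_lt0_crossing f x l :
  is_derive x 1 f l -> f x = 0 -> l < 0 ->
  exists2 d, 0 < d & forall y, (x < y < x + d -> f y < 0) /\
                               (x - d < y < x -> 0 < f y).
Proof.
move=> /is_derive_epsP df fx0 l0.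
have [|d d0 dP] := df (- l); first by rewrite oppr_gt0.
exists d => // y.
have key : y != x -> `|y - x| < d -> (y - x)^-1 * f y < 0.
  move=> yx yd; have := dP (y - x); rewrite subr_eq0 subrK fx0 subr0.
  by move=> /(_ yx yd); rewrite ltr_norml => /andP[]; lra.
split=> /andP[y1 y2].
- have : (y - x)^-1 * f y < 0.
    by apply: key; [rewrite gt_eqF|rewrite ltr_norml; lra].
  by rewrite pmulr_rlt0// invr_gt0 subr_gt0.
- have : (y - x)^-1 * f y < 0.
    by apply: key; [rewrite lt_eqF|rewrite ltr_norml; lra].
  by rewrite nmulr_rlt0// invr_lt0 subr_lt0.
Qed.

Lemma is_derive_segment_continuous f df a b :
  (forall x, a <= x <= b -> is_derive x 1 f (df x)) ->
  {within `[a, b], continuous f}.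
Proof.
move=> H; apply: derivable_within_continuous => x; rewrite in_itv /= => xab.
by have [] := H x xab.
Qed.

(** After a first zero the function is negative; it would have to come back to
    zero before a second one, and cannot do so from below with a negative
    slope. *)
Lemma zero_unique f df :
  (forall x, 0 < x -> is_derive x 1 f (df x)) ->
  (forall x, 0 < x -> f x = 0 -> df x < 0) ->
  forall a b, 0 < a -> 0 < b -> f a = 0 -> f b = 0 -> a = b.
Proof.
move=> fd fz.
suff H a b : 0 < a -> a < b -> f a = 0 -> f b = 0 -> False.
  move=> a b a0 b0 fa fb; case: (ltgtP a b) => // ab; exfalso.
    exact: (H a b).
  exact: (H b a).
move=> a0 ab fa fb; have b0 := lt_trans a0 ab.
have [d d0 dP] := derive_lt0_crossing (fd a a0) fa (fz a a0 fa).
(* A point between the two zeros at which the function is already negative. *)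
pose a' := Num.min (a + d / 2) ((a + b) / 2).
have aa' : a < a' by rewrite lt_min; apply/andP; split; lra.
have a'b : a' < b by rewrite gt_min; apply/orP; right; lra.
have fa' : f a' < 0.
  apply: (dP a').1; rewrite aa' /=.
  by rewrite gt_min; apply/orP; left; lra.
pose A := [set x | a' <= x <= b /\ 0 <= f x].
have Ab : A b by split; rewrite ?fb// (ltW a'b) lexx.
have hA : has_inf A.
  by split; [exists b|exists a' => x [/andP[]]].
pose c := inf A.
have a'c : a' <= c by apply: lb_le_inf; [exists b|move=> x [/andP[]]].
have cb : c <= b by apply: ge_inf => //; case: hA.
have c0 : 0 < c by lra.
have fcont : {for c, continuous f}.
  by apply/differentiable_continuous/derivable1_diffP; have [] := fd c c0.
have below x : a' <= x -> x < c -> f x < 0.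
  move=> a'x xc; rewrite ltNge; apply/negP => fx.
  suff : c <= x by rewrite leNgt xc.
  by apply: ge_inf; [case: hA|split=> //; apply/andP; split=> //; lra].
have fc0 : 0 <= f c.
  rewrite leNgt; apply/negP => fc.
  have /cvgrPdist_lt/(_ (- f c)) := fcont; rewrite oppr_gt0 => /(_ fc).
  move=> /nbhs_ballP[e /= e0 eP].
  have [x Ax xc] := @inf_adherent _ A e e0 hA.
  have cx : c <= x by apply: ge_inf => //; case: hA.
  have := eP x; rewrite /ball /= => /(_ _)/wrap[].
    by rewrite -/c in xc; rewrite ltr_norml; lra.
  by case: Ax => _ fx; rewrite ltr_norml => /andP[]; lra.
have a'c' : a' < c.
  by rewrite lt_neqAle a'c andbT; apply: contraTneq fa' => ->; rewrite -leNgt.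
have fc : f c = 0.
  apply/eqP; rewrite eq_le fc0 andbT leNgt; apply/negP => fcp.
  have /cvgrPdist_lt/(_ (f c) fcp) := fcont.
  move=> /nbhs_ballP[e /= e0 eP].
  pose x := Num.max a' (c - e / 2).
  have xc : x < c by rewrite gt_max; apply/andP; split=> //; lra.
  have := eP x; rewrite /ball /= => /(_ _)/wrap[].
    have : c - e / 2 <= x by rewrite le_max lexx orbT.
    by rewrite ltr_norml; lra.
  have := below x; rewrite le_max lexx /= => /(_ isT xc).
  by rewrite ltr_norml => + /andP[]; lra.
have [e e0 eP] := derive_lt0_crossing (fd c c0) fc (fz c c0 fc).
pose x := Num.max a' (c - e / 2).
have xc : x < c by rewrite gt_max; apply/andP; split=> //; lra.
have cex : c - e / 2 <= x by rewrite le_max lexx orbT.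
have : 0 < f x by apply: (eP x).2; lra.
by have := below x; rewrite le_max lexx /= => /(_ isT xc); lra.
Qed.

Lemma MVT_two_sided f df a b :
  (forall x, Num.min a b <= x <= Num.max a b -> is_derive x 1 f (df x)) ->
  exists2 c, Num.min a b <= c <= Num.max a b & f b - f a = df c * (b - a).
Proof.
have main u v : u <= v -> (forall x, u <= x <= v -> is_derive x 1 f (df x)) ->
    exists2 c, u <= c <= v & f v - f u = df c * (v - u).
  move=> uv H.
  have [|c] := @MVT_segment _ f df u v uv _ (is_derive_segment_continuous H).
    by move=> x; rewrite in_itv /= => /andP[x1 x2]; apply: H; rewrite !ltW.
  by rewrite in_itv /= => cuv e; exists c.
case: (leP a b) => ab H; first exact: main.
have [c cab e] := main b a (ltW ab) H.
by exists c => //; move: e; lra.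
Qed.

(** Chain rule along the graph of [r].  The difference quotient is split at
    [g a (r x)]: the second part is a composition in one variable, and the mean
    value theorem together with the joint continuity of the first partial
    derivative controls the first part. *)
Lemma is_derive_curve (g : R -> R -> R) r dr a :
  C1_on_positive_quadrant g -> 0 < a -> 0 < r a -> is_derive a 1 r dr ->
  is_derive a 1 (fun x => g x (r x)) (dp g a (r a) + drho g a (r a) * dr).
Proof.
move=> gC1 a0 ra0 rd.
have [d1 d2 c1 _] := gC1 a (r a) a0 ra0.
have D2 : is_derive (r a) 1 (fun y => g a y) (drho g a (r a)).
  exact: derivable_is_derive1.
have D2r : is_derive a 1 (fun x => g a (r x)) (drho g a (r a) * dr).
  have /= := @is_derive1_comp R (fun y => g a y) r a _ _ D2 rd.
  by rewrite /comp mulrC.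
suff D1 : is_derive a 1 (fun x => g x (r x) - g a (r x)) (dp g a (r a)).
  have -> : (fun x => g x (r x)) =
      (fun x => g x (r x) - g a (r x)) + (fun x => g a (r x)).
    by apply/funext => x; rewrite fctE subrK.
  exact: is_deriveD.
apply/is_derive_epsP => eps eps0.
have /cvgrPdist_lt/(_ eps eps0) := c1.
move=> /nbhs_ballP[e /= e0 eP].
have rc : {for a, continuous r}.
  by apply/differentiable_continuous/derivable1_diffP; have [] := rd.
have /cvgrPdist_lt/(_ (Num.min e (r a))) := rc.
rewrite lt_min e0 ra0 => /(_ isT) /nbhs_ballP[k /= k0 kP].
exists (Num.min (Num.min e k) a); first by rewrite !lt_min e0 k0 a0.
move=> h h0; rewrite !lt_min -andbA => /and3P[he hk ha].
have := kP (h + a); rewrite /ball /= => /(_ _)/wrap[].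
  by rewrite opprD addrCA subrr addr0 normrN.
rewrite lt_min !ltr_norml => /andP[r1 r2].
have rp : 0 < r (h + a) by lra.
have [|c cb E] := MVT_two_sided (f := fun x => g x (r (h + a)))
    (df := fun x => dp g x (r (h + a))) (a := a) (b := h + a).
  move=> x /andP[x1 _]; have x0 : 0 < x.
    apply: lt_le_trans x1; rewrite lt_min a0 /=.
    by move: ha; rewrite ltr_norml; lra.
  have [dd _ _ _] := gC1 x (r (h + a)) x0 rp.
  exact: derivable_is_derive1.
rewrite /= in E.
have -> : h^-1 * (g (h + a) (r (h + a)) - g a (r (h + a)) -
    (g a (r a) - g a (r a))) = dp g c (r (h + a)).
  by rewrite subrr subr0 E addrK mulrC mulfK.
have H := eP (c, r (h + a)); rewrite /ball /= in H; rewrite -ltr_norml; apply: H.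
split => /=; rewrite /ball /= ltr_norml//.
move: cb he; rewrite ge_min le_max ltr_norml => /andP[/orP c1' /orP c2'].
by case: c1'; case: c2'; lra.
Qed.

End Calculus.

(** * The dual cone of physical states *)

Section StateCone.
Variable R : realType.
Implicit Types (c u : state R) (a b : R).

(** The Euclidean pairing of the state space with its dual. *)
Definition lin c u : R := c.1.1 * u.1.1 + c.1.2 * u.1.2 + c.2 * u.2.

(** Generators of the dual of the cone [0 <= D], [sqrt (D^2 + m^2) <= E]. *)
Definition causal c : Prop :=
  c = (1, 0, 0) \/ c.2 = 1 /\ c.1.1 ^+ 2 + c.1.2 ^+ 2 <= 1.

Definition physical u : Prop := 0 < u.1.1 /\ 0 < qfun u.

Lemma linD c u v : lin c (u + v) = lin c u + lin c v.
Proof. by rewrite /lin /=; ring. Qed.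

Lemma linB c u v : lin c (u - v) = lin c u - lin c v.
Proof. by rewrite /lin /=; ring. Qed.

Lemma linZ c k u : lin c (k *: u) = k * lin c u.
Proof. by rewrite /lin /= /GRing.scale /=; ring. Qed.

(** Cauchy-Schwarz. *)
Lemma disk_pairing_ge a b x y n : 0 <= n -> a ^+ 2 + b ^+ 2 <= 1 ->
  x ^+ 2 + y ^+ 2 <= n ^+ 2 -> - n <= a * x + b * y.
Proof.
move=> n0 ab xy.
have H : (a * x + b * y) ^+ 2 <= n ^+ 2.
  apply: (@le_trans _ _ ((a ^+ 2 + b ^+ 2) * (x ^+ 2 + y ^+ 2))).
    have := sqr_ge0 (a * y - b * x); nra.
  rewrite -[leRHS]mul1r ler_pM// addr_ge0 ?sqr_ge0//.
by rewrite leNgt; apply/negP => zn; nra.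
Qed.

Lemma qfun_le a b u : a ^+ 2 + b ^+ 2 <= 1 -> qfun u <= lin (a, b, 1) u.
Proof.
case: u => [[D m] E] ab; rewrite /qfun /lin /= mul1r.
rewrite addrC lerD2r.
apply: disk_pairing_ge; rewrite ?sqrtr_ge0// sqr_sqrtr//.
by rewrite addr_ge0 ?sqr_ge0.
Qed.

(** With [qfun_le]: [qfun] is a minimum of linear forms, hence concave. *)
Lemma qfun_attained u :
  exists a b, a ^+ 2 + b ^+ 2 <= 1 /\ lin (a, b, 1) u = qfun u.
Proof.
case: u => [[D m] E]; rewrite /qfun /lin /=.
have s0 : 0 <= D ^+ 2 + m ^+ 2 by rewrite addr_ge0 ?sqr_ge0.
set n := Num.sqrt _.
have n2 : n ^+ 2 = D ^+ 2 + m ^+ 2 by rewrite sqr_sqrtr.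
have [n0|n0] := eqVneq n 0.
  exists 0, 0; split; first by rewrite expr0n addr0 ler01.
  by rewrite n0 /=; ring.
exists (- D / n), (- m / n); split.
  by rewrite !expr_div_n !sqrrN -mulrDl -n2 divff// expf_neq0.
have -> : - D / n * D + - m / n * m + 1 * E = E - (D ^+ 2 + m ^+ 2) / n by ring.
by rewrite -n2 expr2 mulfK.
Qed.

Lemma physicalP u : physical u <-> forall c, causal c -> 0 < lin c u.
Proof.
split=> [[D0 q0] [[a b] c] [->|/= [-> ab]]|H].
- by rewrite /lin /= !mul0r !addr0 mul1r.
- exact: lt_le_trans (qfun_le _ ab).
split; first by have := H (1, 0, 0) (or_introl erefl);
  rewrite /lin /= !mul0r !addr0 mul1r.
have [a [b [ab <-]]] := qfun_attained u.
by apply: H; right.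
Qed.

Lemma causal_mass : causal (1, 0, 0). Proof. by left. Qed.

Lemma causal_mass_energy : causal (1, 0, 1).
Proof. by right; rewrite /= expr1n expr0n addr0. Qed.

Lemma physical_bounds u : physical u ->
  [/\ 0 < u.1.1, 0 < u.2 & `|u.1.2| <= u.2].
Proof.
move=> [D0 q0].
have key a b : a ^+ 2 + b ^+ 2 <= 1 -> 0 < lin (a, b, 1) u.
  by move=> ab; apply: lt_le_trans (qfun_le _ ab).
have := key 0 0; have := key 0 (-1); have := key 0 1.
rewrite /lin /= !expr2 !mulrNN !mulr0 !mul1r !add0r !mul0r !mulN1r.
move=> /(_ (lexx _)) h1 /(_ (lexx _)) h2 /(_ ler01) h3.
rewrite ler_norml; split=> //; lra.
Qed.

(** The source of the factor 2 in the stability bound, and of its strictness: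
    [|m| <= E], and a whole [D] is left over. *)
Lemma l1norm_lt u : physical u -> l1norm u + u.1.1 <= 2 * lin (1, 0, 1) u.
Proof.
case: u => [[D m] E] /physical_bounds[/= D0 E0 mE].
rewrite /lin /l1norm /= (gtr0_norm D0) (gtr0_norm E0); lra.
Qed.

Lemma lin_le_l1norm u : `|lin (1, 0, 1) u| <= l1norm u.
Proof.
case: u => [[D m] E]; rewrite /lin /l1norm /= !mul1r mul0r addr0.
by rewrite (le_trans (ler_normD _ _))// lerD2r lerDl.
Qed.

End StateCone.

(** * Admissible states are physical and their fluxes are dominated *)

Section EquationOfState.
Variables (R : realType) (e : R -> R -> R).
Hypothesis eosP : eos_assumptions e.
Implicit Types (u c : state R) (p rho v : R).

Let h := enthalpy e.

(** The lower bound on the enthalpy in polynomial form: multiplied by [rho] and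
    squared. *)
Lemma enthalpy_gap p rho : 0 < p -> 0 < rho ->
  p < rho * h p rho - p /\ rho ^+ 2 + p ^+ 2 <= (rho * h p rho - p) ^+ 2.
Proof.
move=> p0 rho0; have [_ /(_ p rho p0 rho0) H _ _ _] := eosP.
have s0 : 0 <= Num.sqrt (1 + p ^+ 2 / rho ^+ 2) by exact: sqrtr_ge0.
have t0 : 0 <= 1 + p ^+ 2 / rho ^+ 2.
  by rewrite addr_ge0// divr_ge0// sqr_ge0.
have key : rho * Num.sqrt (1 + p ^+ 2 / rho ^+ 2) <= rho * h p rho - p.
  have -> : rho * h p rho - p = rho * (h p rho - p / rho).
    by field; rewrite gt_eqF.
  by rewrite ler_pM2l// lerBrDr.
have sq : (rho * Num.sqrt (1 + p ^+ 2 / rho ^+ 2)) ^+ 2 = rho ^+ 2 + p ^+ 2.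
  by rewrite exprMn sqr_sqrtr//; field; rewrite gt_eqF.
set t := rho * Num.sqrt _ in key sq.
have t1 : 0 <= t by rewrite mulr_ge0// ltW.
have pt : p < t by rewrite ltNge; apply/negP => tp; nra.
split; nra.
Qed.

Lemma energy_gt0 p rho : 0 < p -> 0 < rho -> 0 < e p rho.
Proof.
move=> p0 rho0; have [H1 H2] := enthalpy_gap p0 rho0.
have E : rho * h p rho - p = rho * (1 + e p rho).
  by rewrite /h /enthalpy; field; rewrite gt_eqF.
rewrite E in H1 H2.
have : rho * 1 < rho * (1 + e p rho).
  by rewrite mulr1 ltNge; apply/negP => H; nra.
by rewrite ltr_pM2l// ltrDl.
Qed.

Lemma lorentz_factorE v : `|v| < 1 ->
  exists g, [/\ 0 < g, g ^+ 2 = 1 - v ^+ 2, g = Num.sqrt (1 - v ^+ 2) &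
                lorentz v = g^-1].
Proof.
move=> v1.
have : 0 < 1 - v ^+ 2 by rewrite subr_gt0 -real_normK ?num_real// expr_lt1.
move=> v2; exists (Num.sqrt (1 - v ^+ 2)).
by rewrite sqrtr_gt0 sqr_sqrtr ?ltW.
Qed.

Lemma primitive_physical u rho v p :
  is_primitive e u (rho, v, p) -> physical u.
Proof.
move=> [rho0 v1 p0 ->]; rewrite -/h.
have [g [g0 g2 _ ->]] := lorentz_factorE v1.
have [H1 H2] := enthalpy_gap p0 rho0.
set a := rho * h p rho in H1 H2 *.
split; rewrite /= ?/qfun; first by rewrite divr_gt0.
have gi : 0 < g^-1 by rewrite invr_gt0.
have gi1 : 1 <= g^-1 by rewrite invf_ge1//; nra.
set w := g^-1 in gi gi1 *.
have w2 : w ^+ 2 * (1 - v ^+ 2) = 1.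
  by rewrite -g2 /w exprVn mulVf// expf_neq0// gt_eqF.
have E0 : 0 < a * w ^+ 2 - p.
  have : a * 1 <= a * w ^+ 2 by rewrite ler_pM2l; [rewrite expr_ge1// ltW|lra].
  lra.
rewrite subr_gt0 -ltr_sqr ?nnegrE ?sqrtr_ge0 ?ltW// sqr_sqrtr; last first.
  by rewrite addr_ge0 ?sqr_ge0.
rewrite -subr_gt0.
have -> : (a * w ^+ 2 - p) ^+ 2 - ((rho * w) ^+ 2 + (a * w ^+ 2 * v) ^+ 2) =
   w ^+ 2 * (a ^+ 2 * (w ^+ 2 * (1 - v ^+ 2)) - 2 * a * p - rho ^+ 2) + p ^+ 2.
  by ring.
rewrite w2 mulr1 ltr_wpDl//; last by rewrite exprn_gt0.
by rewrite mulr_ge0 ?sqr_ge0//; nra.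
Qed.

(** The components of [u + F u] are those of a state of energy
    [a / (1 - v) - p], where [a = rho h].  The difference between the squares
    of this energy and of the other two components is [(1 + v) / (1 - v)] times
    [a^2 - 2 a p - rho^2], which is nonnegative by [enthalpy_gap].  The
    reflection [v |-> - v] turns [u + F u] into [u - F u]. *)
Lemma primitive_flux_dominated u rho v p c :
  is_primitive e u (rho, v, p) -> causal c ->
  let f : state R := (u.1.1 * v, v * u.1.2 + p, u.1.2) in
  0 <= lin c (u + f) /\ 0 <= lin c (u - f).
Proof.
move=> [rho0 v1 p0 ->]; rewrite -/h.
have [g [g0 g2 _ ->]] := lorentz_factorE v1.
have [H1 H2] := enthalpy_gap p0 rho0.
set a := rho * h p rho in H1 H2 *.
set w := g^-1; have w0 : 0 < w by rewrite invr_gt0.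
have w2 : w ^+ 2 = ((1 - v) * (1 + v))^-1.
  by rewrite /w exprVn g2; congr (_^-1); ring.
have /andP[v3 v4] : -1 < v < 1 by rewrite -ltr_norml.
have r0 : 0 < rho * w by rewrite mulr_gt0.
have cone (x z : R) (y : R * R) (n : R) : 0 <= n -> x ^+ 2 + z ^+ 2 <= n ^+ 2 -> y.1 ^+ 2 + y.2 ^+ 2 <= 1 ->
    0 <= y.1 * x + y.2 * z + 1 * n.
  by move=> n0 xz y1; have := disk_pairing_ge n0 y1 xz; lra.
have pos t : -1 < t -> t < 1 -> 0 <= a / (1 - t) - p.
  move=> t1 t2; rewrite subr_ge0 ler_pdivlMr ?subr_gt0//; nra.
have sq t : -1 < t -> t < 1 ->
    (rho ^+ 2) * ((1 + t) / (1 - t)) + (a * t / (1 - t) + p) ^+ 2 <=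
    (a / (1 - t) - p) ^+ 2.
  move=> t1 t2; rewrite -subr_ge0.
  have -> : (a / (1 - t) - p) ^+ 2 -
     (rho ^+ 2 * ((1 + t) / (1 - t)) + (a * t / (1 - t) + p) ^+ 2) =
     (1 + t) / (1 - t) * (a ^+ 2 - 2 * a * p - rho ^+ 2).
    by field; rewrite subr_eq0 eq_sym lt_eqF.
  rewrite mulr_ge0//; last by nra.
  by rewrite divr_ge0//; lra.
have n1 : 1 - v != 0 by rewrite subr_eq0 eq_sym lt_eqF.
have n2 : 1 + v != 0 by rewrite gt_eqF//; lra.
case=> [->|].
  by rewrite /lin /=; split; rewrite !mul0r !addr0 mul1r; nra.
case: c => [[c1 c2] c3] /= [-> cc]; rewrite /lin /=; split.
- have -> : a * w ^+ 2 - p + a * w ^+ 2 * v = a / (1 - v) - p.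
    by rewrite w2; field; rewrite n1 n2.
  apply: (cone _ _ (c1, c2)) => //=; first exact: pos.
  apply: le_trans (sq _ v3 v4).
  have -> : a * w ^+ 2 * v + (v * (a * w ^+ 2 * v) + p) = a * v / (1 - v) + p.
    by rewrite w2; field; rewrite n1 n2.
  have -> // : (rho * w + rho * w * v) ^+ 2 = rho ^+ 2 * ((1 + v) / (1 - v)).
  have -> : (rho * w + rho * w * v) ^+ 2 = rho ^+ 2 * (w ^+ 2 * (1 + v) ^+ 2) by ring.
  by rewrite w2; field; rewrite n1 n2.
- have m1 : -1 < - v by lra.
  have m2 : - v < 1 by lra.
  have -> : a * w ^+ 2 - p - a * w ^+ 2 * v = a / (1 - - v) - p.
    by rewrite w2 opprK; field; rewrite n1 n2.
  apply: (cone _ _ (c1, c2)) => //=; first exact: pos.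
  apply: le_trans (sq _ m1 m2).
  have -> : a * w ^+ 2 * v - (v * (a * w ^+ 2 * v) + p) = - (a * - v / (1 - - v) + p).
    by rewrite w2 opprK; field; rewrite n1 n2.
  rewrite sqrrN.
  have -> // : (rho * w - rho * w * v) ^+ 2 = rho ^+ 2 * ((1 + - v) / (1 - - v)).
  have -> : (rho * w - rho * w * v) ^+ 2 = rho ^+ 2 * (w ^+ 2 * (1 - v) ^+ 2) by ring.
  by rewrite w2 opprK; field; rewrite n1 n2.
Qed.

(** Replaces the Lax-Friedrichs splitting: with the speed of light as
    numerical viscosity, [u + F u] and [u - F u] stay in the closed cone. *)
Lemma lin_flux_ge0 u c : admissible e u -> causal c ->
  0 <= lin c (u + flux e u) /\ 0 <= lin c (u - flux e u).
Proof.
move=> [rho [v [p [prim _ _]]]] cc; rewrite /flux.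
have : is_primitive e u (primitive e u) by apply: xgetPex; exists (rho, v, p).
case: (primitive e u) => [[rho' v'] p'] prim'.
have := primitive_flux_dominated prim' cc.
by case: u {prim prim'} => [[D m] E].
Qed.

Lemma admissible_physical u : admissible e u -> physical u.
Proof. by move=> [rho [v [p [/primitive_physical]]]]. Qed.

End EquationOfState.

(** * Physical states are admissible: recovery of the pressure *)

Section PressureRecovery.
Variables (R : realType) (e : R -> R -> R).
Hypothesis eosP : eos_assumptions e.
Implicit Types (u c : state R) (p rho v : R).

Let h := enthalpy e.

Lemma enthalpy_partials p rho : 0 < p -> 0 < rho ->
  is_derive p 1 (fun p' => h p' rho) (dp e p rho + rho^-1) /\
  is_derive rho 1 (fun rho' => h p rho') (drho e p rho - p / rho ^+ 2).
Proof.
move=> p0 rho0; have [/(_ p rho p0 rho0)[d1 d2 _ _] _ _ _ _] := eosP.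
have D1 : is_derive p 1 (fun p' => e p' rho) (dp e p rho).
  exact: (derivable_is_derive1 d1).
have D2 : is_derive rho 1 (fun rho' => e p rho') (drho e p rho).
  exact: (derivable_is_derive1 d2).
split.
  have -> : (fun p' => h p' rho) =
      cst 1 + (fun p' => e p' rho) + (rho^-1 \*: @id R).
    by apply/funext => x; rewrite /h /enthalpy !fctE /GRing.scale /= mulrC.
  have -> : dp e p rho + rho^-1 = 0 + dp e p rho + rho^-1 *: (1 : R).
    by rewrite add0r /GRing.scale /= mulr1.
  exact: is_deriveD (is_deriveD (is_derive_cst _ _ _) D1) (is_deriveZ _ _).
have rN : rho != 0 by rewrite gt_eqF.
have -> : (fun rho' => h p rho') =
    cst 1 + (fun rho' => e p rho') + (p \*: (fun y : R => y^-1)).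
  by apply/funext => x; rewrite /h /enthalpy !fctE /GRing.scale.
have -> : drho e p rho - p / rho ^+ 2 =
    0 + drho e p rho + p *: (- rho ^- 2 *: (1 : R)).
  by rewrite add0r /GRing.scale /= mulr1 mulrN.
apply: is_deriveD (is_deriveD (is_derive_cst _ _ _) D2) (is_deriveZ _ _).
exact: (is_deriveV rN (is_derive_id rho 1)).
Qed.

Lemma enthalpy_C1 : C1_on_positive_quadrant h.
Proof.
move=> p rho p0 rho0.
have [[d1 _] [d2 _]] := enthalpy_partials p0 rho0.
have [/(_ p rho p0 rho0)[_ _ c1 c2] _ _ _ _] := eosP.
have cfst : {for (p, rho), continuous (@fst R R)} by exact: cvg_fst.
have csnd : {for (p, rho), continuous (@snd R R)} by exact: cvg_snd.
have pos : \forall z \near nbhs (p, rho), 0 < z.1 /\ 0 < z.2.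
  by apply: filterI; [exact: (cfst _ (lt_nbhsr p0))|exact: (csnd _ (lt_nbhsr rho0))].
have cv1 : {for (p, rho), continuous (fun z : R * R => dp e z.1 z.2 + z.2^-1)}.
  apply: continuousD; first exact: c1.
  by apply: continuousV; [rewrite gt_eqF|exact: csnd].
have cv2 : {for (p, rho), continuous
    (fun z : R * R => drho e z.1 z.2 - z.1 / z.2 ^+ 2)}.
  apply: continuousB; first exact: c2.
  apply: continuousM; first exact: cfst.
  apply: continuousV; first by rewrite expf_neq0// gt_eqF.
  have -> : (fun x : R * R => x.2 ^+ 2) = (fun x : R * R => x.2 * x.2).
    by apply/funext => x; rewrite expr2.
  by apply: continuousM; exact: csnd.
have E1 p' r' : 0 < p' -> 0 < r' -> dp h p' r' = dp e p' r' + r'^-1.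
  move=> p'0 r'0; have [D _] := enthalpy_partials p'0 r'0.
  by rewrite {1}/dp derive1E derive_val.
have E2 p' r' : 0 < p' -> 0 < r' -> drho h p' r' = drho e p' r' - p' / r' ^+ 2.
  move=> p'0 r'0; have [_ D] := enthalpy_partials p'0 r'0.
  by rewrite {1}/drho derive1E derive_val.
split; [exact: d1|exact: d2| |].
- rewrite /prop_for /continuous_at /= E1//.
  apply: cvg_trans cv1; apply: near_eq_cvg.
  by near=> z; rewrite E1//; have [] : 0 < z.1 /\ 0 < z.2 by near: z.
- rewrite /prop_for /continuous_at /= E2//.
  apply: cvg_trans cv2; apply: near_eq_cvg.
  by near=> z; rewrite E2//; have [] : 0 < z.1 /\ 0 < z.2 by near: z.
Unshelve. all: by end_near. Qed.

(** Makes up for the absence of any joint limit of [e] as [p] tends to 0 or to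
    infinity: along the curve of candidate densities, the enthalpy is compared
    with its values at a fixed density. *)
Lemma enthalpy_decr p rho1 rho2 : 0 < p -> 0 < rho1 -> rho1 <= rho2 ->
  h p rho2 <= h p rho1.
Proof.
move=> p0 r1 r12.
have [|c] := MVT_two_sided (f := fun y => h p y) (df := fun y => drho h p y)
    (a := rho1) (b := rho2).
  move=> y; rewrite (min_l r12) (max_r r12) => /andP[y1 _].
  have y0 : 0 < y by lra.
  have [_ d _ _] := enthalpy_C1 p0 y0.
  exact: (derivable_is_derive1 d).
rewrite (min_l r12) (max_r r12) => /andP[c1 _] E.
have c0 : 0 < c by lra.
have [_ _ /(_ p c p0 c0)[_ dneg] _ _] := eosP.
rewrite -subr_le0 E; rewrite mulr_le0_ge0 ?subr_ge0//.
exact: ltW.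
Qed.

Section Recovery.
Variable u : state R.
Hypothesis uP : physical u.

Let D := u.1.1.
Let m := u.1.2.
Let E := u.2.

(* For a pressure [p], the relations defining the primitive variables force
   [v = m / (E + p)], [W = (E + p) / S p] and [rho = r p]; the one that is left
   is [S p = D * h], i.e. [Phi p = 0]. *)
Let S p := Num.sqrt ((E + p) ^+ 2 - m ^+ 2).
Let r p := D * (S p / (E + p)).
Let Phi p := S p - D * h p (r p).

Let D0 : 0 < D. Proof. by have [] := physical_bounds uP. Qed.
Let E0 : 0 < E. Proof. by have [] := physical_bounds uP. Qed.

Let q0 : D ^+ 2 + m ^+ 2 < E ^+ 2.
Proof.
move: uP E0; rewrite /physical /D /m /E; case: u => [[D' m'] E'] /=.
rewrite subr_gt0 => -[_ H] E'0.
by rewrite -ltr_sqrt// ?exprn_gt0// (sqrtr_sqr E') gtr0_norm.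
Qed.

Let rad_gt0 p : 0 <= p -> D ^+ 2 < (E + p) ^+ 2 - m ^+ 2.
Proof. by have := q0; have := E0; nra. Qed.

Let S2 p : 0 <= p -> S p ^+ 2 = (E + p) ^+ 2 - m ^+ 2.
Proof.
by move=> /rad_gt0 H; rewrite sqr_sqrtr// ltW//; apply: le_lt_trans H; rewrite sqr_ge0.
Qed.

Let S_gtD p : 0 <= p -> D < S p.
Proof.
move=> p0; rewrite -(gtr0_norm D0) -sqrtr_sqr ltr_sqrt; first exact: rad_gt0.
by apply: le_lt_trans (rad_gt0 p0); rewrite sqr_ge0.
Qed.

Let X0 p : 0 <= p -> 0 < E + p. Proof. by have := E0; lra. Qed.

Let S_leX p : 0 <= p -> S p <= E + p.
Proof.
move=> p0; rewrite -(gtr0_norm (X0 p0)) -sqrtr_sqr ler_wsqrtr//.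
by rewrite lerBlDr lerDl sqr_ge0.
Qed.

Let S0 p : 0 <= p -> 0 < S p.
Proof. by move=> p0; apply: lt_trans (S_gtD p0). Qed.

Let r_gt0 p : 0 <= p -> 0 < r p.
Proof. by move=> p0; rewrite /r mulr_gt0// divr_gt0// ?S0// X0. Qed.

Let is_derive_S p : 0 <= p -> is_derive p 1 S ((E + p) / S p).
Proof.
move=> p0.
have D1 : is_derive p 1 (fun x => (E + x) ^+ 2 - m ^+ 2) (2 * (E + p)).
  have DX := is_deriveD (is_derive_cst E p 1) (is_derive_id p 1).
  have -> : (fun x => (E + x) ^+ 2 - m ^+ 2) =
      (cst E + id) * (cst E + id) - cst (m ^+ 2).
    by apply/funext => x; rewrite !fctE expr2.
  have := is_deriveB (is_deriveM DX DX) (is_derive_cst (m ^+ 2) p 1).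
  move=> H; apply: (is_derive_eq H).
  by rewrite !fctE /GRing.scale /= add0r subr0 mulr1; ring.
have pos : 0 < (E + p) ^+ 2 - m ^+ 2.
  by apply: le_lt_trans (rad_gt0 p0); rewrite sqr_ge0.
have D2 := @is_derive1_comp R Num.sqrt (fun x => (E + x) ^+ 2 - m ^+ 2) p _ _
  (is_derive1_sqrt pos) D1.
rewrite /S; apply: is_derive_eq D2 _.
rewrite -/(S p); have : S p != 0 by rewrite gt_eqF// S0.
by move=> ?; field.
Qed.

Let is_derive_r p : 0 <= p ->
  is_derive p 1 r (D * (m ^+ 2 / (S p * (E + p) ^+ 2))).
Proof.
move=> p0.
have DS := is_derive_S p0.
have XN : E + p != 0 by rewrite gt_eqF// X0.
have SN : S p != 0 by rewrite gt_eqF// S0.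
have DX : is_derive p 1 (fun x => E + x) 1.
  by move: (is_deriveD (is_derive_cst E p 1) (is_derive_id p 1)); rewrite add0r.
have DV := is_deriveV XN DX.
have := is_deriveZ D (is_deriveM DS DV).
move=> H; apply: (is_derive_eq H); rewrite /GRing.scale /= !mulr1.
have -> : m ^+ 2 = (E + p) ^+ 2 - S p ^+ 2 by rewrite S2//; ring.
by field; rewrite XN SN.
Qed.

Let dPhi p := (E + p) / S p -
  D * (dp h p (r p) + drho h p (r p) * (D * (m ^+ 2 / (S p * (E + p) ^+ 2)))).

Let is_derive_Phi p : 0 < p -> is_derive p 1 Phi (dPhi p).
Proof.
move=> p0; have p0' := ltW p0.
have DS := is_derive_S p0'.
have Dh := is_derive_curve enthalpy_C1 p0 (r_gt0 p0') (is_derive_r p0').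
exact: is_deriveB DS (is_deriveZ D Dh).
Qed.

(* At a zero, [h = S / D], and the bound on the sound speed becomes a bound on
   [dp h] under which the remaining terms add up to a positive multiple of
   [drho h]. *)
Let dPhi_lt0 p : 0 < p -> Phi p = 0 -> dPhi p < 0.
Proof.
move=> p0 Pz; have p0' := ltW p0.
have SDh : S p = D * h p (r p) by apply/eqP; rewrite -subr_eq0; apply/eqP.
have [_ _ /(_ p (r p) p0 (r_gt0 p0'))[H1 H2] _ _] := eosP.
rewrite -/h in H1 H2.
have XN : E + p != 0 by rewrite gt_eqF// X0.
have SN : S p != 0 by rewrite gt_eqF// S0.
have DN : D != 0 by rewrite gt_eqF.
have X1 := X0 p0'; have S1 := S0 p0'.
have hE : h p (r p) = S p / D by rewrite SDh mulrC mulKf.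
rewrite hE in H1.
rewrite /dPhi; set hp := dp h p (r p) in H1 *; set hr := drho h p (r p) in H1 H2 *.
have H3 : (E + p) / S p - D * hp < D ^+ 2 / S p * hr.
  have -> : (E + p) / S p - D * hp = D ^+ 2 / S p * (S p / D * (1 / r p - hp)).
    by rewrite /r; field; rewrite XN SN DN.
  by rewrite ltr_pM2l// divr_gt0// exprn_gt0.
have H4 : D ^+ 2 / S p * hr -
    D * (hr * (D * (m ^+ 2 / (S p * (E + p) ^+ 2)))) =
    hr * (D ^+ 2 * S p / (E + p) ^+ 2).
  have -> : m ^+ 2 = (E + p) ^+ 2 - S p ^+ 2 by rewrite S2//; ring.
  by field; rewrite XN SN.
have H5 : hr * (D ^+ 2 * S p / (E + p) ^+ 2) < 0.
  by rewrite nmulr_rlt0// divr_gt0// ?exprn_gt0// mulr_gt0// exprn_gt0.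
by rewrite mulrDr opprD addrA; apply: lt_trans H5; rewrite -H4 ltrD2r.
Qed.

(* [r] increases from [r 0 > 0], so that [h p (r p) <= h p (r 0)], which tends
   to 1, while [S p >= S 0 > D]. *)
Let Phi_pos_near0 : exists2 p, 0 < p & 0 < Phi p.
Proof.
have [_ _ _ /(_ (r 0) (r_gt0 (lexx 0))) lim0 _] := eosP.
(* Chosen so that [D * (1 + 2 * eta) = S 0]. *)
pose eta := (S 0 - D) / (2 * D).
have eta0 : 0 < eta by rewrite divr_gt0// ?mulr_gt0// subr_gt0 S_gtD.
have /cvgrPdist_lt/(_ eta eta0) := lim0.
rewrite near_withinE => /nbhs_ballP[d /= d0 dP].
pose p := Num.min (d / 2) (eta * r 0 / 2).
have r00 := r_gt0 (lexx 0).
have p0 : 0 < p by rewrite lt_min !divr_gt0// mulr_gt0.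
have pd : p < d.
  have : p <= d / 2 by rewrite ge_min lexx.
  lra.
have peta : p / r 0 < eta.
  rewrite ltr_pdivrMr//.
  have : p <= eta * r 0 / 2 by rewrite ge_min lexx orbT.
  have : 0 < eta * r 0 by rewrite mulr_gt0.
  lra.
exists p => //; have p0' := ltW p0.
have rr : r 0 <= r p.
  rewrite /r ler_pM2l// addr0 ler_pdivrMr// mulrAC ler_pdivlMr ?X0//.
  rewrite -ler_sqr ?nnegrE ?mulr_ge0 ?sqrtr_ge0 ?(ltW E0) ?(ltW (X0 p0'))//.
  rewrite !exprMn !S2// addr0.
  have : E ^+ 2 <= (E + p) ^+ 2 by have := E0; nra.
  by have := sqr_ge0 m; nra.
have hh := enthalpy_decr p0 r00 rr.
have SS : S 0 <= S p.
  by rewrite /S ler_wsqrtr// lerD2r; have := E0; nra.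
have := dP p; rewrite /ball /= sub0r normrN gtr0_norm// sub0r normrN.
move=> /(_ pd p0); rewrite ltr_norml => /andP[_ ep].
have : D * h p (r p) < D * (1 + eta + eta).
  by rewrite ltr_pM2l// (le_lt_trans hh)// /h /enthalpy; lra.
have -> : D * (1 + eta + eta) = S 0.
  by rewrite /eta; field; rewrite gt_eqF.
by rewrite /Phi; lra.
Qed.

(* [r p <= D], so that [D * h p (r p) >= D + D * e p D + p], while
   [S p <= E + p]. *)
Let Phi_neg_far p1 : exists2 p, p1 < p & 0 < p /\ Phi p < 0.
Proof.
have [_ _ _ _ /(_ D D0) /cvgryPgt/(_ (E / D)) [M [_ MP]]] := eosP.
pose p := `|M| + `|p1| + 1.
have Mp : M < p.
  by rewrite /p; have := ler_norm M; have := normr_ge0 p1; lra.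
have p1p : p1 < p.
  by rewrite /p; have := ler_norm p1; have := normr_ge0 M; lra.
have p0 : 0 < p by rewrite /p; have := normr_ge0 p1; have := normr_ge0 M; lra.
exists p => //; split=> //; have p0' := ltW p0.
have := MP p Mp; rewrite /= ltr_pdivrMr// => eD.
have rD : r p <= D.
  by rewrite /r ger_pMr// ler_pdivrMr ?X0// mul1r; exact: S_leX.
have := enthalpy_decr p0 (r_gt0 p0') rD.
rewrite -(ler_pM2l D0).
have -> : D * h p D = D + D * e p D + p.
  by rewrite /h /enthalpy; field; rewrite gt_eqF.
by have := S_leX p0'; have := D0; rewrite /Phi; lra.
Qed.

Let Phi_zero : exists2 p, 0 < p & Phi p = 0.
Proof.
have [p1 p10 P1] := Phi_pos_near0.
have [p2 p12 [p20 P2]] := Phi_neg_far p1.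
have cont : {within `[p1, p2], continuous Phi}.
  apply: (is_derive_segment_continuous (df := dPhi)) => x /andP[x1 _].
  by apply: is_derive_Phi; lra.
have [|c] := IVT (v := 0) (ltW p12) cont.
  by rewrite ge_min le_max (ltW P1) (ltW P2) orbT.
by rewrite in_itv /= => /andP[c1 _] Pc; exists c => //; lra.
Qed.

Let primitiveE rho v p : is_primitive e u (rho, v, p) ->
  [/\ 0 < p, Phi p = 0, v = m / (E + p) & rho = r p].
Proof.
move=> [rho0 v1 p0 uE]; rewrite -/h in uE.
have [g [g0 g2 _ W]] := lorentz_factorE v1.
have gN : g != 0 by rewrite gt_eqF.
have DE : D = rho / g by rewrite /D uE /= W.
have XE : E + p = rho * h p rho / g ^+ 2 by rewrite /E uE /= W subrK exprVn.
have mE : m = (E + p) * v by rewrite /m uE /= W XE exprVn.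
have X1 := X0 (ltW p0).
have SE : S p = (E + p) * g.
  rewrite /S mE exprMn -{1}[_ ^+ 2]mulr1 -mulrBr -g2 -exprMn sqrtr_sqr.
  by rewrite gtr0_norm// mulr_gt0.
have rE : rho = r p.
  by rewrite /r SE DE; field; rewrite gN gt_eqF.
split=> //; last by rewrite mE [_ * v]mulrC mulfK// gt_eqF.
rewrite /Phi -rE SE XE DE.
by field; rewrite gN.
Qed.

Let zero_primitive p : 0 < p -> Phi p = 0 ->
  is_primitive e u (r p, m / (E + p), p).
Proof.
move=> p0 Pz; have p0' := ltW p0.
have X1 := X0 p0'; have S1 := S0 p0'.
have XN : E + p != 0 by rewrite gt_eqF.
have SN : S p != 0 by rewrite gt_eqF.
have gE : Num.sqrt (1 - (m / (E + p)) ^+ 2) = S p / (E + p).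
  have -> : 1 - (m / (E + p)) ^+ 2 = (S p / (E + p)) ^+ 2.
    rewrite !expr_div_n S2//; field; exact: XN.
  by rewrite sqrtr_sqr gtr0_norm// divr_gt0.
have SDh : D * h p (r p) = S p by apply/eqP; rewrite eq_sym -subr_eq0; apply/eqP.
split=> //; first exact: r_gt0.
  rewrite normrM normfV (gtr0_norm X1) ltr_pdivrMr// mul1r.
  rewrite -ltr_sqr ?nnegrE ?(ltW X1)// real_normK ?num_real//.
  by rewrite -subr_gt0; apply: le_lt_trans (rad_gt0 p0'); rewrite sqr_ge0.
rewrite -/h /lorentz gE.
have h1 : r p * (S p / (E + p))^-1 = D.
  by rewrite /r; field; rewrite XN SN.
have h2 : r p * h p (r p) * (S p / (E + p))^-1 ^+ 2 = E + p.
  have -> : r p * h p (r p) = (D * h p (r p)) * (S p / (E + p)).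
    by rewrite {1}/r; ring.
  by rewrite SDh; field; rewrite XN SN.
rewrite h1 h2 addrK [(E + p) * _]mulrC divfK//.
by rewrite /D /m /E; case: (u) => [[]].
Qed.

(** Together with [admissible_physical]: for an admissible equation of state, the
    admissible set is a convex cone that does not depend on [e]. *)
Lemma physical_admissible : admissible e u.
Proof.
have [p p0 Pz] := Phi_zero.
exists (r p), (m / (E + p)), p; split; first exact: zero_primitive.
  move=> [[rho v] p'] /primitiveE[p'0 Pz' -> ->].
  by rewrite (zero_unique is_derive_Phi dPhi_lt0 p'0 p0 Pz' Pz).
by apply: (energy_gt0 eosP) => //; rewrite r_gt0// ltW.
Qed.

End Recovery.
End PressureRecovery.

(** * Integrals of polynomials, averages and quadrature *)

Section PolynomialIntegrals.
Variable R : realType.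
Implicit Types (f g : {poly R}) (a b : R).

(** Lets all the integrals below be computed as differences of values of
    polynomials. *)
Lemma poly_antiderivative f : exists g, g^`() = f.
Proof.
exists (\poly_(i < (size f).+1) (f`_i.-1 / i%:R)).
apply/polyP => i; rewrite coef_deriv coef_poly ltnS /=.
case: ltnP => [_|le]; last by rewrite mul0rn nth_default.
by rewrite -(mulr_natr (_ / _)) divfK// pnatr_eq0.
Qed.

Lemma integral_deriv_poly g a b : a < b ->
  \int[lebesgue_measure]_(x in `[a, b]) (g^`()).[x] = g.[b] - g.[a].
Proof.
move=> ab; rewrite /Rintegral.
have cont f : {within `[a, b], continuous (horner f)}.
  by apply: continuous_subspaceT => x; exact: continuous_horner.
rewrite (@continuous_FTC2 _ _ (horner g))//.
  split.
  - by move=> x _; exact: derivable_horner.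
  - by apply: cvg_at_right_filter; exact: continuous_horner.
  - by apply: cvg_at_left_filter; exact: continuous_horner.
by move=> x _; rewrite derive1E derive_val.
Qed.

End PolynomialIntegrals.

Section CellAverages.
Variable R : realType.
Implicit Types (f g w : {poly R}) (a b t y : R) (c u : state R) (P : pstate R).

Definition pint a b f : R := \int[lebesgue_measure]_(x in `[a, b]) f.[x].

Lemma pint_linear a b k f g : a < b ->
  pint a b (k *: f + g) = k * pint a b f + pint a b g.
Proof.
move=> ab; have [F <-] := poly_antiderivative f.
have [G <-] := poly_antiderivative g.
rewrite /pint -derivZ -derivD !integral_deriv_poly//.
by rewrite !hornerD !hornerZ; ring.
Qed.

Lemma pintD a b f g : a < b -> pint a b (f + g) = pint a b f + pint a b g.
Proof. by move=> ab; rewrite -[f]scale1r pint_linear// scale1r mul1r. Qed.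

Lemma pintZ a b k f : a < b -> pint a b (k *: f) = k * pint a b f.
Proof.
move=> ab; have H0 : pint a b 0 = 0.
  by have := pintD 0 0 ab; rewrite addr0; lra.
by rewrite -[k *: f]addr0 pint_linear// H0 addr0.
Qed.

Lemma pintB a b f g : a < b -> pint a b (f - g) = pint a b f - pint a b g.
Proof. by move=> ab; rewrite -scaleN1r pintD// pintZ// mulN1r. Qed.

Lemma pint_cat a b d f : a < b -> b < d -> pint a d f = pint a b f + pint b d f.
Proof.
move=> ab bd; have [F <-] := poly_antiderivative f.
by rewrite /pint !integral_deriv_poly ?(lt_trans ab bd)//; ring.
Qed.

Lemma pint_affine a b y k f : a < b -> 0 < k ->
  pint (y + k * a) (y + k * b) f = k * pint a b (f \Po (y%:P + k *: 'X)).
Proof.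
move=> ab k0; have [F <-] := poly_antiderivative f.
have E : (F \Po (y%:P + k *: 'X))^`() = k *: (F^`() \Po (y%:P + k *: 'X)).
  by rewrite deriv_comp derivD derivC add0r derivZ derivX -scalerAr mulr1.
rewrite -pintZ// -E /pint !integral_deriv_poly ?ltrD2l ?ltr_pM2l//.
by rewrite !horner_comp !hornerE.
Qed.

Lemma pint_opp f : pint (-1) 1 (f \Po - 'X) = pint (-1) 1 f.
Proof.
have lt11 : (-1 : R) < 1 by lra.
have [F <-] := poly_antiderivative f.
have E : - (F \Po - 'X)^`() = F^`() \Po - 'X.
  by rewrite deriv_comp derivN derivX mulrN1 opprK.
rewrite -E -derivN /pint !integral_deriv_poly//.
by rewrite !hornerN !horner_comp !hornerE !opprK addrC.
Qed.

(** [lin c] applied to the coefficients. *)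
Definition linp c P : {poly R} := c.1.1 *: P.1.1 + c.1.2 *: P.1.2 + c.2 *: P.2.

Lemma horner_linp c P x : (linp c P).[x] = lin c (evalp P x).
Proof. by rewrite /linp /lin /= !hornerD !hornerZ. Qed.

Lemma linpD c P Q : linp c (P + Q) = linp c P + linp c Q.
Proof. by rewrite /linp /= !scalerDr; ring. Qed.

Lemma linpZ c k P : linp c (k *: P) = k *: linp c P.
Proof. by rewrite /linp /= !scalerDr !scalerA !(mulrC k). Qed.

Lemma linpB c P Q : linp c (P - Q) = linp c P - linp c Q.
Proof. by rewrite -scaleN1r linpD linpZ scaleN1r. Qed.

Lemma size_linp c P K : degree_le K P -> (size (linp c P) <= K.+1)%N.
Proof.
have z k f : (size f <= K.+1)%N -> (size (k *: f) <= K.+1)%N.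
  exact: leq_trans (size_scale_leq _ _).
move=> [d1 d2 d3]; rewrite (leq_trans (size_polyD _ _))// geq_max z// andbT.
by rewrite (leq_trans (size_polyD _ _))// geq_max !z.
Qed.

Lemma lin_vint1 a b c P : a < b -> lin c (vint a b P 1) = pint a b (linp c P).
Proof.
move=> ab; rewrite /linp !pintD// !pintZ// /lin /vint /=.
have E f : \int[lebesgue_measure]_(x in `[a, b]) (f.[x] * (1 : {poly R}).[x])
    = pint a b f.
  by congr Rintegral; apply/funext => x; rewrite hornerC mulr1.
by rewrite !E.
Qed.

Section Cell.
Variable s : cdg R.
Hypothesis sP : cdg_valid s.

Let dx0 : 0 < dx s. Proof. by case: sP => [[]]. Qed.
Let tau0 : 0 < tau s. Proof. by case: sP => [[]]. Qed.

Definition lobatto_mean f y : R :=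
  \sum_(a < npts (lobatto s))
    weight (lobatto s) a * f.[halfnode s (lobatto s) y a].

(** The Gauss-Lobatto rule is exact up to degree [2 L - 3], which is at least
    [K]. *)
Lemma lobatto_meanE f y : (size f <= (deg s).+1)%N ->
  lobatto_mean f y = (dx s / 2)^-1 * pint (y - dx s / 4) (y + dx s / 4) f.
Proof.
move=> fs; have [_ [_ [_ _ _ [_ _ _ _ ex]] _ dL]] := sP.
have k0 : 0 < dx s / 4 by rewrite divr_gt0.
pose q : {poly R} := y%:P + (dx s / 4) *: 'X.
pose g := f \Po q.
have qs : (size q <= 2)%N.
  rewrite (leq_trans (size_polyD _ _))// geq_max.
  rewrite (leq_trans (size_polyC_leq1 _))//=.
  by rewrite (leq_trans (size_scale_leq _ _))// size_polyX.
have gs : (size g <= 2 * npts (lobatto s) - 2)%N.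
  apply: leq_trans (size_comp_poly_leq _ _) _.
  have : ((size f).-1 * (size q).-1 <= (size f).-1 * 1)%N.
    by rewrite leq_mul2l; lia.
  lia.
have lt11 : (-1 : R) < 1 by lra.
have -> : lobatto_mean f y =
    \sum_(a < npts (lobatto s)) weight (lobatto s) a * g.[node (lobatto s) a].
  by apply: eq_bigr => a _; rewrite /g /q horner_comp !hornerE.
rewrite ex// -/(pint _ _ _).
have -> : y - dx s / 4 = y + dx s / 4 * -1 by rewrite mulrN1.
have -> : y + dx s / 4 = y + dx s / 4 * 1 by rewrite mulr1.
rewrite pint_affine// -/q -/g; field; rewrite gt_eqF//.
Qed.

Lemma average_linE c ctr P : degree_le (deg s) P ->
  lin c (average s ctr P) =
  2^-1 * (lobatto_mean (linp c P) (ctr - dx s / 4) +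
          lobatto_mean (linp c P) (ctr + dx s / 4)).
Proof.
move=> dP; rewrite /average linZ lin_vint1; last by have := dx0; lra.
rewrite !lobatto_meanE ?size_linp//.
rewrite (@pint_cat _ ctr); [|have := dx0; lra|have := dx0; lra].
have -> : ctr - dx s / 4 - dx s / 4 = ctr - dx s / 2 by field.
have -> : ctr - dx s / 4 + dx s / 4 = ctr by rewrite subrK.
have -> : ctr + dx s / 4 - dx s / 4 = ctr by rewrite addrK.
have -> : ctr + dx s / 4 + dx s / 4 = ctr + dx s / 2 by field.
by field; rewrite gt_eqF.
Qed.

(** The weak form tested with the constant 1. *)
Lemma average_update c ctr U Ul Ur Rc t :
  degree_le (deg s) U -> degree_le (deg s) Ul -> degree_le (deg s) Ur ->
  cell_weak_form s ctr U Ul Ur Rc ->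
  lin c (average s ctr (U + t *: Rc)) =
    (1 - t / tau s) * lin c (average s ctr U) +
    t / tau s * (2^-1 * (lobatto_mean (linp c Ul) (ctr - dx s / 4) +
                         lobatto_mean (linp c Ur) (ctr + dx s / 4))) +
    t / dx s * (lin c (flux (eos s) (evalp Ul (ctr - dx s / 2))) -
                lin c (flux (eos s) (evalp Ur (ctr + dx s / 2)))).
Proof.
move=> dU dl dr /(_ 1); rewrite size_poly1 => /(_ isT).
rewrite big1 => [|a _]; last by rewrite derivC !hornerC !scale0r addr0 scaler0.
rewrite scaler0 addr0 !hornerC !scale1r => /(congr1 (lin c)).
have l1 : ctr - dx s / 2 < ctr + dx s / 2 by have := dx0; lra.
have l2 : ctr - dx s / 2 < ctr by have := dx0; lra.
have l3 : ctr < ctr + dx s / 2 by have := dx0; lra.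
rewrite linB !linD linZ linD !lin_vint1// !linpB !pintB// => E.
rewrite /average !linZ !lin_vint1// linpD linpZ pintD// pintZ// E.
rewrite !lobatto_meanE ?size_linp// (pint_cat (linp c U) l2 l3).
have -> : ctr - dx s / 4 - dx s / 4 = ctr - dx s / 2 by field.
have -> : ctr - dx s / 4 + dx s / 4 = ctr by rewrite subrK.
have -> : ctr + dx s / 4 - dx s / 4 = ctr by rewrite addrK.
have -> : ctr + dx s / 4 + dx s / 4 = ctr + dx s / 2 by field.
by field; rewrite !gt_eqF.
Qed.

End Cell.

(** Both end weights are equal.  With [P] the polynomial vanishing at the
    interior nodes, [(1 - x) P(x) P(-x)] and its reflection
    [(1 + x) P(-x) P(x)] have the same integral, are of degree [2 L - 3], and
    the rule sees only the left end point of the first and only the right end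
    point of the second. *)
Lemma lobatto_end_weights (r : quadrature R) : is_gauss_lobatto r ->
  weight r (npts r).-1 = weight r 0%N.
Proof.
case: r => L x w [/= L1 x0 xl [/= mono _ _ _ ex]].
case: L L1 xl mono ex => [//|[//|n]] _ /= xl mono ex.
pose P : {poly R} := \prod_(i < n) ('X - (x i.+1)%:P).
pose Q : {poly R} := P \Po - 'X.
have P1 t : P.[t] = \prod_(i < n) (t - x i.+1).
  by rewrite /P horner_prod; apply: eq_bigr => i _; rewrite hornerXsubC.
have sP : size P = n.+1 by rewrite size_prod_XsubC /index_enum -enumT size_enum_ord.
have sN : size (- 'X : {poly R}) = 2%N by rewrite size_polyN size_polyX.
have sQ : (size Q <= n.+1)%N by rewrite /Q size_comp_poly2// sP.
pose f : {poly R} := (1 - 'X) * (P * Q).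
pose g : {poly R} := (1 + 'X) * (Q * P).
have gf : g = f \Po - 'X.
  rewrite /f /g /Q !comp_polyM comp_polyB comp_polyX comp_polyC opprK.
  have XX : (- 'X : {poly R}) \Po - 'X = 'X by rewrite raddfN /= comp_polyX opprK.
  by rewrite -comp_polyA XX comp_polyXr.
have sPQ : (size (P * Q)%R <= (n + n).+1)%N.
  by apply: leq_trans (size_polyMleq _ _) _; rewrite sP; lia.
have sf : (size f <= 2 * n.+2 - 2)%N.
  apply: leq_trans (size_polyMleq _ _) _.
  have : (size (1 - 'X : {poly R})%R <= 2)%N.
    by rewrite (leq_trans (size_polyD _ _))// geq_max size_poly1 size_polyN size_polyX.
  by move: sPQ; set k := size _; set l := size _; lia.
have sg : (size g <= 2 * n.+2 - 2)%N.
  by rewrite gf size_comp_poly2.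
have := ex _ sf; have := ex _ sg; rewrite -!/(pint _ _ _) gf pint_opp => <-.
rewrite -gf.
have ends h : h = f \/ h = g ->
    \sum_(i < n.+2) w i * h.[x i] = w 0%N * h.[-1] + w n.+1 * h.[1].
  move=> H; rewrite big_ord_recl big_ord_recr /= x0 /bump /= !add1n xl.
  rewrite big1 ?add0r// => i _; rewrite !add1n.
  have Pz : P.[x i.+1] = 0 by rewrite P1 (bigD1 i)//= subrr mul0r.
  by case: H => ->; rewrite /f /g !hornerM Pz ?mul0r ?mulr0 ?mul0r ?mulr0.
rewrite !ends; [|by right|by left].
have PN1 : P.[-1] != 0.
  rewrite P1; apply/prodf_neq0 => i _; rewrite subr_eq0.
  rewrite -x0 lt_eqF// mono//=; have := ltn_ord i; lia.
have PP1 : P.[1] != 0.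
  rewrite P1; apply/prodf_neq0 => i _; rewrite subr_eq0.
  rewrite -xl gt_eqF// mono//=; have := ltn_ord i; lia.
have Qv t : Q.[t] = P.[- t] by rewrite /Q horner_comp !hornerE.
have fv t : f.[t] = (1 - t) * (P.[t] * P.[- t]).
  by rewrite /f !hornerM Qv !hornerE.
have gv t : g.[t] = (1 + t) * (P.[- t] * P.[t]).
  by rewrite /g !hornerM Qv !hornerE.
rewrite !fv !gv !opprK => H.
apply: (mulfI (_ : P.[1] * P.[-1] * 2 != 0)); last by lra.
by rewrite !mulf_neq0// pnatr_eq0.
Qed.

End CellAverages.

(** * The limiter *)

Section Limiter.
Variables (R : realType) (s : cdg R).
Hypothesis sP : cdg_valid s.
Implicit Types (f g : {poly R}) (c u : state R) (P U : pstate R) (ctr eps : R).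

Let dx0 : 0 < dx s. Proof. by case: sP => [[]]. Qed.

Definition cell_mean ctr f : R :=
  (dx s)^-1 * pint (ctr - dx s / 2) (ctr + dx s / 2) f.

Let cell_lt ctr : ctr - dx s / 2 < ctr + dx s / 2.
Proof. by have := dx0; lra. Qed.

Lemma averageE ctr P : average s ctr P = map3 (cell_mean ctr) P.
Proof.
have E f : \int[lebesgue_measure]_(x in `[ctr - dx s / 2, ctr + dx s / 2])
    (f.[x] * (1 : {poly R}).[x]) = pint (ctr - dx s / 2) (ctr + dx s / 2) f.
  by congr Rintegral; apply/funext => x; rewrite hornerC mulr1.
by rewrite /average /vint /map3 !E.
Qed.

Lemma cell_mean_linear ctr k f g :
  cell_mean ctr (k *: f + g) = k * cell_mean ctr f + cell_mean ctr g.
Proof. by rewrite /cell_mean pint_linear//; ring. Qed.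

Lemma cell_meanC ctr a : cell_mean ctr a%:P = a.
Proof.
have E : a%:P = (a *: 'X)^`() :> {poly R} by rewrite derivZ derivX alg_polyC.
rewrite /cell_mean /pint E integral_deriv_poly// !hornerZ !hornerX.
by field; rewrite gt_eqF.
Qed.

Lemma cell_mean_contract ctr k f :
  cell_mean ctr (k *: (f - (cell_mean ctr f)%:P) + (cell_mean ctr f)%:P) =
  cell_mean ctr f.
Proof.
rewrite cell_mean_linear cell_meanC addrC -[f - _]addrC -scaleN1r.
rewrite -[_ *: _%:P]addr0 -addrA add0r cell_mean_linear cell_meanC.
by ring.
Qed.

Lemma size_contract f k a K : (size f <= K.+1)%N ->
  (size (k *: (f - a%:P) + a%:P)%R <= K.+1)%N.
Proof.
move=> fK; have aK : (size (a%:P : {poly R}) <= K.+1)%N.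
  by rewrite (leq_trans (size_polyC_leq1 _)).
rewrite (leq_trans (size_polyD _ _))// geq_max aK andbT.
rewrite (leq_trans (size_scale_leq _ _))//.
by rewrite (leq_trans (size_polyD _ _))// geq_max fK size_polyN.
Qed.

Lemma lin_contract c k P u x :
  lin c (evalp (k *: (P - constp u) + constp u) x) =
  k * (lin c (evalp P x) - lin c u) + lin c u.
Proof.
case: P u => [[P1 P2] P3] [[u1 u2] u3]; rewrite /lin /= !hornerD !hornerZ.
by rewrite !hornerD !hornerN !hornerC; ring.
Qed.

Lemma average_linear ctr k P Q :
  average s ctr (k *: P + Q) = k *: average s ctr P + average s ctr Q.
Proof.
by rewrite !averageE; case: P Q => [[? ?] ?] [[? ?] ?];
  rewrite /map3 /= !cell_mean_linear.
Qed.

Lemma averageD ctr P Q :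
  average s ctr (P + Q) = average s ctr P + average s ctr Q.
Proof. by rewrite -[P]scale1r average_linear !scale1r. Qed.

Lemma averageZ ctr k P : average s ctr (k *: P) = k *: average s ctr P.
Proof.
have H0 : average s ctr 0 = 0.
  by have := averageD ctr 0 0; rewrite addr0 => /esym/eqP; rewrite -subr_eq0 addrK => /eqP.
by rewrite -[k *: P]addr0 average_linear H0 addr0.
Qed.

Lemma big_min_le (f : R -> R) z x (r : seq R) : x \in r ->
  \big[Num.min/z]_(y <- r) f y <= f x.
Proof.
elim: r => [//|y r IH]; rewrite inE big_cons => /orP[/eqP->|/IH H].
  by rewrite ge_min lexx.
by rewrite ge_min H orbT.
Qed.

(** The scaling factors of the limiter pull the values at the nodes up to
    [eps]. *)
Lemma contract_ge (b eps mn y : R) : mn < eps -> eps <= b -> mn <= y ->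
  let k := (b - eps) / (b - mn) in
  [/\ 0 <= k, k <= 1 & eps <= k * (y - b) + b].
Proof.
move=> me eb my k; have bm : 0 < b - mn by lra.
have k0 : 0 <= k by rewrite divr_ge0 ?subr_ge0 ?(ltW (lt_le_trans me eb)).
split=> //; first by rewrite ler_pdivrMr// mul1r; lra.
have E : k * (mn - b) + b = eps.
  by rewrite /k; field; rewrite gt_eqF.
by rewrite -E lerD2r ler_wpM2l// lerD2r.
Qed.

(** The definition with the average computed component by component. *)
Lemma pcp_limiterE eps ctr D m E :
  let Db := cell_mean ctr D in
  let Ub : state R := (Db, cell_mean ctr m, cell_mean ctr E) in
  let Dmin := node_min s ctr (fun x => D.[x]) in
  let Dh := if Dmin < eps
    then ((Db - eps) / (Db - Dmin)) *: (D - Db%:P) + Db%:P else D in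
  let Uh : pstate R := (Dh, m, E) in
  let qmin := node_min s ctr (fun x => qfun (evalp Uh x)) in
  pcp_limiter s eps ctr (D, m, E) =
    if qmin < eps
    then ((qfun Ub - eps) / (qfun Ub - qmin)) *: (Uh - constp Ub) + constp Ub
    else Uh.
Proof. by rewrite /pcp_limiter averageE. Qed.

(** Both steps contract the solution towards its average, which is thereby
    kept.  The first one makes the density at least [eps] at the nodes; the
    second one does not spoil this, the average density being at least [eps],
    and by concavity makes [qfun] at least [eps]. *)
Lemma pcp_limiterP eps ctr U :
  degree_le (deg s) U -> 0 < eps ->
  eps <= (average s ctr U).1.1 -> eps <= qfun (average s ctr U) ->
  [/\ degree_le (deg s) (pcp_limiter s eps ctr U),
      average s ctr (pcp_limiter s eps ctr U) = average s ctr U &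
      {in cell_nodes s ctr, forall x,
        physical (evalp (pcp_limiter s eps ctr U) x)}].
Proof.
case: U => [[D m] E] [dD dm dE] eps0; rewrite /= in dD dm dE.
rewrite pcp_limiterE [average s ctr (D, m, E)]averageE [map3 _ _]/map3.
set Db := cell_mean ctr D; set mb := cell_mean ctr m; set Eb := cell_mean ctr E.
rewrite [(_, _, _).1.1]/= => eD eq.
set Dmin := node_min s ctr (fun x => D.[x]); set Dh := if Dmin < eps then _ else D.
have [sDh aDh Dhx] : [/\ (size Dh <= (deg s).+1)%N, cell_mean ctr Dh = Db &
    {in cell_nodes s ctr, forall x, eps <= Dh.[x]}].
  have DminP x : x \in cell_nodes s ctr -> Dmin <= D.[x] by exact: big_min_le.
  rewrite /Dh; case: ltP => De; last first.
    by split=> // x /DminP; exact: le_trans.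
  split; [exact: size_contract|exact: cell_mean_contract|].
  move=> x /DminP Dx; rewrite !hornerE.
  by have [_ _] := contract_ge De eD Dx.
set Uh : pstate R := (Dh, m, E); set Ub : state R := (Db, mb, Eb).
set qmin := node_min s ctr (fun x => qfun (evalp Uh x)).
have qminP x : x \in cell_nodes s ctr -> qmin <= qfun (evalp Uh x).
  exact: big_min_le.
case: ltP => qe; last first.
  split=> //; first by rewrite averageE /map3 /= aDh.
  move=> x xn; split; first exact: lt_le_trans (Dhx x xn).
  by apply: lt_le_trans (qminP x xn); exact: lt_le_trans qe.
set k := _ / _; split.
- by split; apply: size_contract.
- rewrite averageE /map3 /= -{1 2}aDh cell_mean_contract aDh.
  by rewrite !cell_mean_contract.
- move=> x xn.
  have [k0 k1 ke] := contract_ge qe eq (qminP x xn).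
  rewrite -/k in k0 k1 ke; move: {qe} k k0 k1 ke => k k0 k1 ke.
  split.
    have -> : (evalp (k *: (Uh - constp Ub) + constp Ub) x).1.1 =
        k * (Dh.[x] - Db) + Db.
      by rewrite /= hornerD hornerZ hornerD hornerN !hornerC.
    by have := Dhx x xn; nra.
  have [a [b [ab <-]]] := qfun_attained (evalp (k *: (Uh - constp Ub) + constp Ub) x).
  rewrite lin_contract.
  have h1 := qfun_le (evalp Uh x) ab; have h2 := qfun_le Ub ab.
  apply: lt_le_trans eps0 (le_trans ke _).
  nra.
Qed.

End Limiter.

(** * Euler steps keep the averages physical *)

Section EulerStep.
Variables (R : realType) (s : cdg R).
Hypothesis eosP : eos_assumptions (eos s).
Hypothesis sP : cdg_valid s.
Implicit Types (f g : {poly R}) (c u : state R) (P U : pstate R) (ctr : R).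
Implicit Types (V L : csol R).

Let dx0 : 0 < dx s. Proof. by case: sP => [[]]. Qed.
Let tau0 : 0 < tau s. Proof. by case: sP => [[]]. Qed.
Let L1 : (1 < npts (lobatto s))%N. Proof. by case: sP => _ [_ []]. Qed.

Definition physical_on_nodes ctr P : Prop :=
  {in cell_nodes s ctr, forall x, physical (evalp P x)}.

Lemma lobatto_left_node ctr a : (a < npts (lobatto s))%N ->
  halfnode s (lobatto s) (ctr - dx s / 4) a \in cell_nodes s ctr.
Proof.
move=> aL; rewrite !mem_cat; apply/orP; right; apply/orP; right; apply/orP; left.
by apply/mapP; exists a; rewrite ?mem_iota.
Qed.

Lemma lobatto_right_node ctr a : (a < npts (lobatto s))%N ->
  halfnode s (lobatto s) (ctr + dx s / 4) a \in cell_nodes s ctr.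
Proof.
move=> aL; rewrite !mem_cat; apply/orP; right; apply/orP; right; apply/orP; right.
by apply/mapP; exists a; rewrite ?mem_iota.
Qed.

Lemma halfnode_first y : halfnode s (lobatto s) y 0%N = y - dx s / 4.
Proof. by case: sP => _ [_ [_ e _ _] _ _]; rewrite /halfnode e mulrN1. Qed.

Lemma halfnode_last y :
  halfnode s (lobatto s) y (npts (lobatto s)).-1 = y + dx s / 4.
Proof. by case: sP => _ [_ [_ _ e _] _ _]; rewrite /halfnode e mulr1. Qed.

(** The only point of a cell at which the scheme evaluates the flux in the
    update of the averages. *)
Lemma center_node ctr : ctr \in cell_nodes s ctr.
Proof.
have e : ctr = halfnode s (lobatto s) (ctr - dx s / 4) (npts (lobatto s)).-1.
  by rewrite halfnode_last subrK.
by rewrite {1}e; apply: lobatto_left_node; rewrite prednK// (ltn_trans _ L1).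
Qed.

Lemma weight_gt0 a : (a < npts (lobatto s))%N -> 0 < weight (lobatto s) a.
Proof. by case: sP => _ [_ [_ _ _ [_ _ H _ _]] _ _]; exact: H. Qed.

(** Strict, because a Gauss-Lobatto rule has at least two nodes: the Euler step
    below uses up one end node and still has a positive remainder. *)
Lemma lobatto_mean_gt f y a :
  (a < npts (lobatto s))%N ->
  (forall b, (b < npts (lobatto s))%N -> 0 < f.[halfnode s (lobatto s) y b]) ->
  weight (lobatto s) a * f.[halfnode s (lobatto s) y a] < lobatto_mean s f y.
Proof.
move=> aL fp; rewrite /lobatto_mean (bigD1 (Ordinal aL))//= ltrDl.
have [b ab] : exists b : 'I_(npts (lobatto s)), b != Ordinal aL.
  have L0 : (0 < npts (lobatto s))%N by rewrite (ltn_trans _ L1).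
  have [a0|a0] := eqVneq a 0%N.
    by exists (Ordinal L1); rewrite -val_eqE /= a0.
  by exists (Ordinal L0); rewrite -val_eqE /= eq_sym.
rewrite (bigD1 b)//= ltr_pwDl ?mulr_gt0 ?weight_gt0 ?fp//.
by apply: sumr_ge0 => i _; rewrite ltW// mulr_gt0 ?weight_gt0 ?fp.
Qed.

Lemma lobatto_mean_gt_left f y :
  (forall b, (b < npts (lobatto s))%N -> 0 < f.[halfnode s (lobatto s) y b]) ->
  weight (lobatto s) 0%N * f.[y - dx s / 4] < lobatto_mean s f y.
Proof.
by rewrite -halfnode_first; apply: lobatto_mean_gt; rewrite (ltn_trans _ L1).
Qed.

Lemma lobatto_mean_gt_right f y :
  (forall b, (b < npts (lobatto s))%N -> 0 < f.[halfnode s (lobatto s) y b]) ->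
  weight (lobatto s) 0%N * f.[y + dx s / 4] < lobatto_mean s f y.
Proof.
have [_ [_ gl _ _]] := sP.
rewrite -halfnode_last -(lobatto_end_weights gl); apply: lobatto_mean_gt.
by rewrite prednK// (ltn_trans _ L1).
Qed.

Lemma physical_average ctr P : degree_le (deg s) P ->
  physical_on_nodes ctr P -> physical (average s ctr P).
Proof.
move=> dP Pp; apply/physicalP => c cc; rewrite average_linE//.
have L0 : (0 < npts (lobatto s))%N by rewrite (ltn_trans _ L1).
have p1 b : (b < npts (lobatto s))%N ->
    0 < (linp c P).[halfnode s (lobatto s) (ctr - dx s / 4) b].
  by move=> bL; rewrite horner_linp; apply: (physicalP _).1 => //;
    apply: Pp; exact: lobatto_left_node.
have p2 b : (b < npts (lobatto s))%N ->
    0 < (linp c P).[halfnode s (lobatto s) (ctr + dx s / 4) b].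
  by move=> bL; rewrite horner_linp; apply: (physicalP _).1 => //;
    apply: Pp; exact: lobatto_right_node.
rewrite mulr_gt0// ?invr_gt0// addr_gt0//.
  by apply: lt_trans (lobatto_mean_gt L0 p1); rewrite mulr_gt0 ?weight_gt0 ?p1.
by apply: lt_trans (lobatto_mean_gt L0 p2); rewrite mulr_gt0 ?weight_gt0 ?p2.
Qed.

(** For a causal [c], the averages over the two half cells of the other mesh
    contain the values at both cell ends with weight [t / tau * w / 2], which is
    at least [t / dx]; the corresponding part dominates the fluxes by
    [lin_flux_ge0]. *)
Lemma euler_cell_physical ctr U Ul Ur Rc (t : R) :
  tau s <= weight (lobatto s) 0%N * dx s / 2 -> 0 < t <= tau s ->
  degree_le (deg s) U -> degree_le (deg s) Ul -> degree_le (deg s) Ur ->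
  physical_on_nodes ctr U -> physical_on_nodes (ctr - dx s / 2) Ul ->
  physical_on_nodes (ctr + dx s / 2) Ur ->
  cell_weak_form s ctr U Ul Ur Rc ->
  physical (average s ctr (U + t *: Rc)).
Proof.
move=> cfl /andP[t0 tt] dU dl dr pU pl pr wf; apply/physicalP => c cc.
rewrite (average_update sP c t dU dl dr wf).
have A0 := (physicalP _).1 (physical_average dU pU) c cc.
have al : admissible (eos s) (evalp Ul (ctr - dx s / 2)).
  by apply: physical_admissible => //; apply: pl; exact: center_node.
have ar : admissible (eos s) (evalp Ur (ctr + dx s / 2)).
  by apply: physical_admissible => //; apply: pr; exact: center_node.
have [Fl _] := lin_flux_ge0 eosP al cc; have [_ Fr] := lin_flux_ge0 eosP ar cc.
rewrite linD in Fl; rewrite linB in Fr.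
have ul := (physicalP _).1 (admissible_physical eosP al) c cc.
have ur := (physicalP _).1 (admissible_physical eosP ar) c cc.
have ml : weight (lobatto s) 0%N * lin c (evalp Ul (ctr - dx s / 2)) <
    lobatto_mean s (linp c Ul) (ctr - dx s / 4).
  have -> : ctr - dx s / 2 = ctr - dx s / 4 - dx s / 4 by field.
  rewrite -horner_linp; apply: lobatto_mean_gt_left => b bL.
  rewrite horner_linp; apply: (physicalP _).1 => //; apply: pl.
  have -> : ctr - dx s / 4 = ctr - dx s / 2 + dx s / 4 by field.
  exact: lobatto_right_node.
have mr : weight (lobatto s) 0%N * lin c (evalp Ur (ctr + dx s / 2)) <
    lobatto_mean s (linp c Ur) (ctr + dx s / 4).
  have -> : ctr + dx s / 2 = ctr + dx s / 4 + dx s / 4 by field.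
  rewrite -horner_linp; apply: lobatto_mean_gt_right => b bL.
  rewrite horner_linp; apply: (physicalP _).1 => //; apply: pr.
  have -> : ctr + dx s / 4 = ctr + dx s / 2 - dx s / 4 by field.
  exact: lobatto_left_node.
move: A0 Fl Fr ul ur ml mr.
set A := lin c (average _ _ _); set fl := lin c (flux _ _).
set fr := lin c (flux _ (evalp Ur _)); set vl := lin c (evalp Ul _).
set vr := lin c (evalp Ur _); set Ml := lobatto_mean _ _ _.
set Mr := lobatto_mean _ _ (ctr + _); set w := weight _ _ in cfl *.
move=> A0 Fl Fr ul ur ml mr.
pose th := t / tau s; pose la := t / dx s.
have th0 : 0 < th by rewrite divr_gt0.
have th1 : th <= 1 by rewrite ler_pdivrMr// mul1r.
have la0 : 0 < la by rewrite divr_gt0.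
have lath : la <= th * (2^-1 * w).
  rewrite ler_pdivrMr//.
  have -> : th * (2^-1 * w) * dx s = th * (w * dx s / 2) by ring.
  by rewrite /th mulrAC ler_pdivlMr// ler_pM2l.
rewrite -/th -/la.
have h1 : th * (2^-1 * (w * vl + w * vr)) < th * (2^-1 * (Ml + Mr)).
  by rewrite ltr_pM2l// ltr_pM2l ?invr_gt0// ltrD.
have h2 : la * (vl + vr) <= th * (2^-1 * (w * vl + w * vr)).
  have -> : th * (2^-1 * (w * vl + w * vr)) = th * (2^-1 * w) * (vl + vr) by ring.
  by rewrite ler_wpM2r// addr_ge0// ltW.
have h3 : 0 <= la * (vl + vr) + la * (fl - fr).
  by rewrite -mulrDr mulr_ge0 ?(ltW la0)//; lra.
have h4 : 0 <= (1 - th) * A by rewrite mulr_ge0// ?subr_ge0// ltW.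
lra.
Qed.

Lemma ctrJ_pred j : ctrJ s (j - 1) = ctrI s j - dx s / 2.
Proof. by rewrite /ctrJ /ctrI intrB; field. Qed.

Lemma ctrI_succ j : ctrI s (j + 1) = ctrJ s j + dx s / 2.
Proof. by rewrite /ctrJ /ctrI intrD; field. Qed.

Lemma ctrI_ctrJ j : ctrI s j = ctrJ s j - dx s / 2.
Proof. by rewrite /ctrJ addrK. Qed.

Definition node_physical V : Prop := forall j : int,
  [/\ degree_le (deg s) (V.1 j), degree_le (deg s) (V.2 j),
      physical_on_nodes (ctrI s j) (V.1 j) &
      physical_on_nodes (ctrJ s j) (V.2 j)].

Definition mean_physical V : Prop := forall j : int,
  [/\ degree_le (deg s) (V.1 j), degree_le (deg s) (V.2 j),
      physical (average s (ctrI s j) (V.1 j)) &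
      physical (average s (ctrJ s j) (V.2 j))].

Lemma node_mean_physical V : node_physical V -> mean_physical V.
Proof.
by move=> H j; have [d1 d2 p1 p2] := H j; split=> //; exact: physical_average.
Qed.

Lemma degree_le_linear K k P U :
  degree_le K P -> degree_le K U -> degree_le K (P + k *: U).
Proof.
have z f g : (size f <= K.+1)%N -> (size g <= K.+1)%N ->
    (size (f + k *: g)%R <= K.+1)%N.
  move=> fK gK; rewrite (leq_trans (size_polyD _ _))// geq_max fK.
  by rewrite (leq_trans (size_scale_leq _ _)).
by move=> [p1 p2 p3] [u1 u2 u3]; split; apply: z.
Qed.

Lemma euler_mean_physical V L (t : R) :
  tau s <= weight (lobatto s) 0%N * dx s / 2 -> 0 < t <= tau s ->
  node_physical V -> is_cdg_operator s V L -> mean_physical (V + t *: L).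
Proof.
move=> cfl tt Vp op j; have [d1 d2 w1 w2] := op j.
have [v1 v2 p1 p2] := Vp j.
have [_ v3 _ p3] := Vp (j - 1); have [v4 _ p4 _] := Vp (j + 1).
split; [exact: degree_le_linear|exact: degree_le_linear| |].
- apply: (euler_cell_physical cfl tt v1 v3 v2 p1 _ _ w1).
    by rewrite -ctrJ_pred.
  exact: p2.
- apply: (euler_cell_physical cfl tt v2 v1 v4 p2 _ _ w2).
    by rewrite -ctrI_ctrJ.
  by rewrite -ctrI_succ.
Qed.

Lemma convex_mean_physical V W a b : 0 < a -> 0 < b ->
  mean_physical V -> mean_physical W -> mean_physical (a *: V + b *: W).
Proof.
move=> a0 b0 VP WP j; have [d1 d2 p1 p2] := VP j; have [e1 e2 q1 q2] := WP j.
have comb ctr P Q : physical (average s ctr P) -> physical (average s ctr Q) ->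
    physical (average s ctr (a *: P + b *: Q)).
  move=> /physicalP pP /physicalP pQ; apply/physicalP => c cc.
  rewrite averageD// !averageZ// linD (linZ _ a) (linZ _ b).
  by rewrite addr_gt0// mulr_gt0// ?pP ?pQ.
have z P Q : degree_le (deg s) P -> degree_le (deg s) Q ->
    degree_le (deg s) (a *: P + b *: Q).
  move=> dP dQ; apply: degree_le_linear => //.
  have sz f : (size f <= (deg s).+1)%N -> (size (a *: f) <= (deg s).+1)%N.
    exact: leq_trans (size_scale_leq _ _).
  by case: dP => ? ? ?; split; apply: sz.
by split; [exact: z|exact: z|exact: comb|exact: comb].
Qed.

Lemma limited_physical V Vt : limited s V Vt -> mean_physical V ->
  node_physical Vt /\
  forall j, average s (ctrI s j) (Vt.1 j) = average s (ctrI s j) (V.1 j) /\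
            average s (ctrJ s j) (Vt.2 j) = average s (ctrJ s j) (V.2 j).
Proof.
move=> lim VP.
have H ctr P Pt : cell_limited s ctr P Pt -> degree_le (deg s) P ->
    physical (average s ctr P) ->
    [/\ degree_le (deg s) Pt, average s ctr Pt = average s ctr P &
        physical_on_nodes ctr Pt].
  move=> cl dP pP.
  have [eps [e0 eD eq ->]] := cl (physical_admissible eosP pP).
  exact: pcp_limiterP.
split=> j; have [l1 l2] := lim j; have [d1 d2 p1 p2] := VP j;
  have [? ? ?] := H _ _ _ l1 d1 p1; have [? ? ?] := H _ _ _ l2 d2 p2; by split.
Qed.

End EulerStep.

(** * Sums over the cells of a period *)

Section IndexSums.
Variable R : realType.
Implicit Types (a b : int -> R) (per : option nat).

(** The cells over which totals are taken: one period of [P] cells for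
    [Some P], all cells for [None]. *)
Definition index_set per : set int :=
  if per is Some P then [set j : int | 1 <= j <= P%:Z] else setT.

Definition has_period per a : Prop :=
  if per is Some P then forall j, a (j + P%:Z) = a j else True.

Definition isum per a : \bar R := (\esum_(j in index_set per) (a j)%:E)%E.

Lemma has_period2 (F : R -> R -> R) per a b :
  has_period per a -> has_period per b ->
  has_period per (fun j => F (a j) (b j)).
Proof. by case: per => [P|//] /= aP bP j; rewrite aP bP. Qed.

Lemma has_periodZ per k a : has_period per a -> has_period per (fun j => k * a j).
Proof. by case: per => [P|//] /= aP j; rewrite aP. Qed.

Lemma has_period_shift per a i :
  has_period per a -> has_period per (fun j => a (j + i)).
Proof. by case: per => [P|//] /= aP j; rewrite addrAC aP. Qed.

Lemma isum_ge0 per a : (forall j, 0 <= a j) -> (0 <= isum per a)%E.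
Proof. by move=> a0; apply: esum_ge0 => j _; rewrite lee_fin. Qed.

Lemma isumD per a b : (forall j, 0 <= a j) -> (forall j, 0 <= b j) ->
  (isum per (fun j => (a j + b j)%R) = isum per a + isum per b)%E.
Proof.
move=> a0 b0; rewrite /isum -esumD; first by apply: eq_esum.
  by move=> j _; rewrite lee_fin.
by move=> j _; rewrite lee_fin.
Qed.

Lemma isum_le per a b : (forall j, a j <= b j) -> (isum per a <= isum per b)%E.
Proof. by move=> ab; apply: le_esum => j _; rewrite lee_fin. Qed.

Lemma eq_isum per a b : (forall j, a j = b j) -> isum per a = isum per b.
Proof. by move=> ab; apply: eq_esum => j _; rewrite ab. Qed.

Lemma esumZ (T : choiceType) (S : set T) (k : R) (a : T -> R) : 0 <= k ->
  (forall j, 0 <= a j) ->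
  (\esum_(j in S) (k * a j)%:E = k%:E * \esum_(j in S) (a j)%:E)%E.
Proof.
move=> k0 a0; rewrite /esum -ereal_supZl//; last first.
  apply/set0P; exists 0%E; exists set0; first exact: fsets_set0.
  by rewrite fsbig_set0.
congr ereal_sup; apply/seteqP; split=> x.
  move=> [X XS <-]; exists (\sum_(j \in X) (a j)%:E)%E; first by exists X.
  by rewrite ge0_mule_fsumr// => j; rewrite lee_fin.
move=> [_ [X XS <-] <-]; exists X => //.
by rewrite ge0_mule_fsumr// => j; rewrite lee_fin.
Qed.

Lemma isumZ per k a : 0 <= k -> (forall j, 0 <= a j) ->
  (isum per (fun j => (k * a j)%R) = k%:E * isum per a)%E.
Proof. exact: esumZ. Qed.

(** On a period, the translation is a cyclic permutation of the indices up to
    the periodicity of the summand. *)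
Lemma isum_succ per a : has_period per a ->
  isum per (fun j => a (j + 1)) = isum per a.
Proof.
case: per => [P|] /= aP; rewrite /isum /=.
  rewrite [RHS](@reindex_esum _ _ _ (index_set (Some P)) _
      (fun j => if j == P%:Z then 1 else j + 1)).
    apply: eq_esum => j /= jP; case: eqP => [->|//].
    by rewrite addrC aP.
  split.
  - by move=> j /=; case: eqP; lia.
  - move=> i j /set_mem /= ? /set_mem /= ?; case: eqP; case: eqP; lia.
  - move=> j /= jP; exists (if j == 1 then P%:Z else j - 1).
      by case: eqP; lia.
    by case: (eqVneq j 1) => [->|j1]; rewrite ?eqxx//; case: eqP; lia.
rewrite [RHS](@reindex_esum _ _ _ setT _ (fun j => j + 1))//.
split=> //.
- by move=> i j _ _; apply: addIr.
- by move=> j _; exists (j - 1); rewrite ?subrK.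
Qed.

Lemma isum_pred per a : has_period per a ->
  isum per (fun j => a (j - 1)) = isum per a.
Proof.
move=> aP; rewrite -(isum_succ (has_period_shift (-1) aP)).
by apply: eq_isum => j; rewrite addrK.
Qed.

Lemma esum_range_cat a (m n p : int) : (forall j, 0 <= a j) ->
  m <= n + 1 -> n <= p ->
  (\esum_(j in [set j : int | (m <= j <= p)%R]) (a j)%:E =
   \esum_(j in [set j : int | (m <= j <= n)%R]) (a j)%:E +
   \esum_(j in [set j : int | (n + 1 <= j <= p)%R]) (a j)%:E)%E.
Proof.
move=> a0 mn np.
rewrite (@esumID _ _ [set j : int | j <= n]); last by move=> j _; rewrite lee_fin.
have -> : [set j : int | m <= j <= p] `&` [set j : int | j <= n] =
    [set j : int | m <= j <= n].
  by apply/seteqP; split=> j /=; [move=> []|move=> ?; split]; lia.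
have -> // : [set j : int | m <= j <= p] `&` ~` [set j : int | j <= n] =
    [set j : int | n + 1 <= j <= p].
apply/seteqP; split=> j /=; first by move=> [? /negP]; lia.
by move=> ?; split; [|apply/negP]; lia.
Qed.

Lemma esum_range_reflect a (c m n : int) :
  \esum_(j in [set j : int | m <= j <= n]) (a (c - j))%:E =
  \esum_(j in [set j : int | c - n <= j <= c - m]) (a j)%:E.
Proof.
rewrite [RHS](@reindex_esum _ _ _ [set j : int | m <= j <= n] _ (fun j => c - j))//.
split.
- by move=> j /=; lia.
- by move=> i j _ _ /=; lia.
- by move=> j /= H; exists (c - j); [rewrite /=|]; lia.
Qed.

End IndexSums.

(** * Conservation of mass plus energy *)

Ltac nonneg := do ?[by []|apply: addr_ge0|apply: mulr_ge0].

Section Conservation.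
Variables (R : realType) (s : cdg R).
Hypothesis eosP : eos_assumptions (eos s).
Hypothesis sP : cdg_valid s.
Implicit Types (V L W : csol R) (per : option nat).

Let dx0 : 0 < dx s. Proof. by case: sP => [[]]. Qed.
Let tau0 : 0 < tau s. Proof. by case: sP => [[]]. Qed.
Let L0 : (0 < npts (lobatto s))%N.
Proof. by case: sP => _ [_ []]; case: npts. Qed.

(* The conserved form [D + E], itself a causal one. *)
Let Y : state R := (1, 0, 1).
Let cY : causal Y := causal_mass_energy R.

Definition solution_has_period per V : Prop :=
  if per is Some P then forall (j : int) (x : R),
    evalp (V.1 (j + P%:Z)) (x + P%:Z%:~R * dx s) = evalp (V.1 j) x /\
    evalp (V.2 (j + P%:Z)) (x + P%:Z%:~R * dx s) = evalp (V.2 j) x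
  else True.

Definition left_mean ctr (P : pstate R) := lobatto_mean s (linp Y P) (ctr - dx s / 4).
Definition right_mean ctr (P : pstate R) := lobatto_mean s (linp Y P) (ctr + dx s / 4).

Lemma ctrI_shift (j i : int) : ctrI s (j + i) = ctrI s j + i%:~R * dx s.
Proof. by rewrite /ctrI intrD; ring. Qed.

Lemma ctrJ_shift (j i : int) : ctrJ s (j + i) = ctrJ s j + i%:~R * dx s.
Proof. by rewrite /ctrJ ctrI_shift; ring. Qed.

Lemma lobatto_mean_translate (P P' : pstate R) (z y : R) :
  (forall x, evalp P' (x + z) = evalp P x) ->
  lobatto_mean s (linp Y P') (y + z) = lobatto_mean s (linp Y P) y.
Proof.
move=> H; apply: eq_bigr => a _; rewrite !horner_linp -H; congr (_ * lin _ (evalp _ _)).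
by rewrite /halfnode; ring.
Qed.

Lemma half_means_have_period per V : solution_has_period per V ->
  [/\ has_period per (fun j => left_mean (ctrI s j) (V.1 j)),
      has_period per (fun j => right_mean (ctrI s j) (V.1 j)),
      has_period per (fun j => left_mean (ctrJ s j) (V.2 j)) &
      has_period per (fun j => right_mean (ctrJ s j) (V.2 j))].
Proof.
case: per => [P|//] /= H; split=> j; rewrite /left_mean /right_mean.
- rewrite ctrI_shift addrAC; apply: lobatto_mean_translate => x.
  by have [] := H j x.
- rewrite ctrI_shift addrAC; apply: lobatto_mean_translate => x.
  by have [] := H j x.
- rewrite ctrJ_shift addrAC; apply: lobatto_mean_translate => x.
  by have [] := H j x.
- rewrite ctrJ_shift addrAC; apply: lobatto_mean_translate => x.
  by have [] := H j x.
Qed.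

Lemma center_values_have_period per V (F : state R -> R) : solution_has_period per V ->
  has_period per (fun j => F (evalp (V.1 j) (ctrI s j))) /\
  has_period per (fun j => F (evalp (V.2 j) (ctrJ s j))).
Proof.
case: per => [P|//] /= H; split=> j.
- by rewrite ctrI_shift; have [-> _] := H j (ctrI s j).
- by rewrite ctrJ_shift; have [_ ->] := H j (ctrJ s j).
Qed.

Definition cell_content V (j : int) : R :=
  lin Y (average s (ctrI s j) (V.1 j)) + lin Y (average s (ctrJ s j) (V.2 j)).

Definition total per V : \bar R := isum per (cell_content V).

Lemma cell_content_gt0 V : mean_physical s V -> forall j, 0 < cell_content V j.
Proof.
move=> VP j; have [_ _ p1 p2] := VP j.
by rewrite addr_gt0//; apply: (physicalP _).1.
Qed.

Lemma csol_step1 V L (t : R) j : (V + t *: L).1 j = V.1 j + t *: L.1 j.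
Proof. by []. Qed.

Lemma csol_step2 V L (t : R) j : (V + t *: L).2 j = V.2 j + t *: L.2 j.
Proof. by []. Qed.

(** Summing the update over the cells, the exchange terms between the two meshes
    cancel and the fluxes telescope.  To sum nonnegative terms only, each flux
    [f] at a cell center is written as [g - v], with [v] the value of [D + E]
    there and [g = v + f >= 0]; moving the negative terms to the left yields
    the identity [balance].  The sums of [g] and [v] are finite, being bounded
    by a multiple of the total, and can be cancelled. *)
Lemma total_conserved per V L (t : R) :
  tau s <= weight (lobatto s) 0%N * dx s / 2 -> 0 < t <= tau s ->
  node_physical s V -> is_cdg_operator s V L -> solution_has_period per V ->
  (total per V < +oo)%E ->
  total per (V + t *: L) = total per V.
Proof.
move=> cfl tt Vp op Vper fin.
have W0 j := ltW (cell_content_gt0 (euler_mean_physical eosP sP cfl tt Vp op) j).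
have Y0 j := ltW (cell_content_gt0 (node_mean_physical sP Vp) j).
pose th := t / tau s; pose la := t / dx s.
have /andP[t0 tT] := tt.
have th0 : 0 < th by rewrite divr_gt0.
have la0 : 0 < la by rewrite divr_gt0.
have th1 : th <= 1 by rewrite ler_pdivrMr// mul1r.
have [cLI cRI cLJ cRJ] := half_means_have_period Vper.
pose vI j := lin Y (evalp (V.1 j) (ctrI s j)).
pose vJ j := lin Y (evalp (V.2 j) (ctrJ s j)).
pose gI j := lin Y (evalp (V.1 j) (ctrI s j) + flux (eos s) (evalp (V.1 j) (ctrI s j))).
pose gJ j := lin Y (evalp (V.2 j) (ctrJ s j) + flux (eos s) (evalp (V.2 j) (ctrJ s j))).
pose mLI j := left_mean (ctrI s j) (V.1 j).
pose mRI j := right_mean (ctrI s j) (V.1 j).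
pose mLJ j := left_mean (ctrJ s j) (V.2 j).
pose mRJ j := right_mean (ctrJ s j) (V.2 j).
have [cvI cvJ] := center_values_have_period (lin Y) Vper.
have [cgI cgJ] := center_values_have_period (fun u => lin Y (u + flux (eos s) u)) Vper.
pose w := weight (lobatto s) 0%N.
have w0 : 0 < w by exact: weight_gt0.
have bounds ctr P : physical_on_nodes s ctr P ->
    [/\ 0 <= lin Y (evalp P ctr),
        0 <= lin Y (evalp P ctr + flux (eos s) (evalp P ctr)),
        lin Y (evalp P ctr + flux (eos s) (evalp P ctr)) <= 2 * lin Y (evalp P ctr),
        w * lin Y (evalp P ctr) <= left_mean ctr P & 0 <= right_mean ctr P].
  move=> pP; have pc : physical (evalp P ctr) by apply: pP; exact: center_node.
  have v0 := (physicalP _).1 pc Y cY.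
  have [g0 g1] := lin_flux_ge0 eosP (physical_admissible eosP pc) cY.
  rewrite linD in g0; rewrite linB in g1.
  rewrite linD; split=> //; [exact: ltW|lra| |].
    rewrite -horner_linp.
    have {1}-> : ctr = ctr - dx s / 4 + dx s / 4 by rewrite subrK.
    apply/ltW/lobatto_mean_gt_right => // b bL; rewrite horner_linp.
    by apply: (physicalP _).1 => //; apply: pP; exact: lobatto_left_node.
  apply: sumr_ge0 => a _; rewrite mulr_ge0//.
    by apply/ltW/weight_gt0.
  rewrite horner_linp; apply/ltW/(physicalP _).1 => //.
  by apply: pP; exact: lobatto_right_node.
have bI j : [/\ 0 <= vI j, 0 <= gI j, gI j <= 2 * vI j, w * vI j <= mLI j & 0 <= mRI j].
  by have [_ _ p1 _] := Vp j; exact: bounds.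
have bJ j : [/\ 0 <= vJ j, 0 <= gJ j, gJ j <= 2 * vJ j, w * vJ j <= mLJ j & 0 <= mRJ j].
  by have [_ _ _ p2] := Vp j; exact: bounds.
have mLI0 j : 0 <= mLI j.
  by have [v _ _ m _] := bI j; apply: le_trans m; rewrite mulr_ge0// ltW.
have mLJ0 j : 0 <= mLJ j.
  by have [v _ _ m _] := bJ j; apply: le_trans m; rewrite mulr_ge0// ltW.
have content j : cell_content V j = 2^-1 * (mLI j + mRI j) + 2^-1 * (mLJ j + mRJ j).
  by have [d1 d2 _ _] := Vp j; rewrite /cell_content !average_linE.
pose k j := la * (vJ j + gI j + gJ j + vI j).
have k0 j : 0 <= k j.
  have [? ? _ _ _] := bI j; have [? ? _ _ _] := bJ j.
  by apply: mulr_ge0; [exact: ltW|do 3![apply: addr_ge0 => //]].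
(* [g <= 2 v], and [w v] is one term of the quadrature over a half cell. *)
have kfin : (isum per k < +oo)%E.
  apply: (@le_lt_trans _ _ (isum per (fun j => (6 * la / w) * cell_content V j))).
    apply: isum_le => j; have [v1 g1 h1 m1 r1] := bI j.
    have [v2 g2 h2 m2 r2] := bJ j.
    have -> : 6 * la / w * cell_content V j = la * (6 * cell_content V j / w) by ring.
    rewrite ler_pM2l// ler_pdivlMr// content.
    have : w * (vJ j + gI j + gJ j + vI j) <= w * (3 * (vI j + vJ j)).
      by rewrite ler_pM2l//; lra.
    by rewrite mulrC; lra.
  have C0 : 0 <= 6 * la / w.
    by apply: divr_ge0; [apply: mulr_ge0 => //; exact: ltW|exact: ltW].
  by rewrite isumZ// lte_mul_pinfty.
pose p j := (1 - th) * cell_content V j + th / 2 * (mLJ j + mRI j) + la * (vJ j + gI j).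
pose q j := th / 2 * mRJ j + la * gJ j.
pose r j := th / 2 * mLI j + la * vI j.
have la0' := ltW la0; have th2 : 0 <= th / 2 by rewrite divr_ge0// ltW.
have th3 : 0 <= 1 - th by rewrite subr_ge0.
have p0 j : 0 <= p j.
  have [? ? _ _ ?] := bI j; have [? ? _ _ _] := bJ j.
  by rewrite /p; nonneg.
have q0 j : 0 <= q j.
  have [? ? _ _ ?] := bJ j.
  by rewrite /q; nonneg.
have r0 j : 0 <= r j.
  have [? ? _ _ ?] := bI j.
  by rewrite /r; nonneg.
have balance j : cell_content (V + t *: L) j +
    (la * (gJ j + vI j) + la * vJ (j - 1) + la * gI (j + 1)) =
    p j + q (j - 1) + r (j + 1).
  have [d1 d2 w1 w2] := op j.
  have [v1 v2 _ _] := Vp j; have [_ v3 _ _] := Vp (j - 1).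
  have [v4 _ _ _] := Vp (j + 1).
  have := average_update sP Y t v2 v1 v4 w2.
  have := average_update sP Y t v1 v3 v2 w1.
  rewrite {1}/cell_content csol_step1 csol_step2.
  move: (lin Y (average s (ctrI s j) (V.1 j + t *: L.1 j))) => A ->.
  move: (lin Y (average s (ctrJ s j) (V.2 j + t *: L.2 j))) => B ->.
  rewrite -ctrJ_pred -/(ctrJ s j) -ctrI_ctrJ -ctrI_succ.
  have e1 : lobatto_mean s (linp Y (V.2 (j - 1))) (ctrI s j - dx s / 4) = mRJ (j - 1).
    by rewrite /mRJ /right_mean ctrJ_pred; congr lobatto_mean; field.
  have e2 : lobatto_mean s (linp Y (V.2 j)) (ctrI s j + dx s / 4) = mLJ j.
    by rewrite /mLJ /left_mean /ctrJ; congr lobatto_mean; field.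
  have e3 : lobatto_mean s (linp Y (V.1 j)) (ctrJ s j - dx s / 4) = mRI j.
    by rewrite /mRI /right_mean /ctrJ; congr lobatto_mean; field.
  have e4 : lobatto_mean s (linp Y (V.1 (j + 1))) (ctrJ s j + dx s / 4) = mLI (j + 1).
    by rewrite /mLI /left_mean ctrI_succ; congr lobatto_mean; field.
  rewrite e1 e2 e3 e4 /p /q /r /cell_content /gI /gJ /vI /vJ !linD -/th -/la.
  by ring.
have lhs0 j : 0 <= la * (gJ j + vI j).
  have [? ? _ _ _] := bI j; have [? ? _ _ _] := bJ j.
  by nonneg.
have lav j : 0 <= la * vJ j by have [? _ _ _ _] := bJ j; rewrite mulr_ge0// ltW.
have lag j : 0 <= la * gI j by have [_ ? _ _ _] := bI j; rewrite mulr_ge0// ltW.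
have cq : has_period per q.
  by apply: (has_period2 (fun a b => a + b)); exact: has_periodZ.
have cr : has_period per r.
  by apply: (has_period2 (fun a b => a + b)); exact: has_periodZ.
have R1 : (isum per (fun j => (p j + q (j - 1) + r (j + 1))%R) =
    total per V + isum per k)%E.
  rewrite (isumD _ (fun j => addr_ge0 (p0 j) (q0 (j - 1))))// isumD//.
  rewrite isum_pred// isum_succ//.
  rewrite -isumD// -isumD//; last by move=> j; rewrite addr_ge0.
  rewrite -isumD//; apply: eq_isum => j; rewrite /p /q /r /k content.
  by field.
have R2 : (isum per (fun j => (cell_content (V + t *: L) j +
    (la * (gJ j + vI j) + la * vJ (j - 1) + la * gI (j + 1)))%R) =
    total per (V + t *: L)%R + isum per k)%E.
  have b1 j : 0 <= la * (gJ j + vI j) + la * vJ (j - 1) by exact: addr_ge0.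
  rewrite (isumD _ W0 (fun j => addr_ge0 (b1 j) (lag (j + 1)))).
  congr (_ + _)%E; rewrite (isumD _ b1 (fun j => lag (j + 1))).
  rewrite (isumD _ lhs0 (fun j => lav (j - 1))).
  rewrite (isum_pred (has_periodZ la cvJ)) (isum_succ (has_periodZ la cgI)).
  rewrite -(isumD _ lhs0 lav) -(isumD _ (fun j => addr_ge0 (lhs0 j) (lav j)) lag).
  by apply: eq_isum => j; rewrite /k /vJ /gI; ring.
have E : (total per (V + t *: L)%R + isum per k = total per V + isum per k)%E.
  by rewrite -R1 -R2; exact: eq_isum.
have kf : isum per k \is a fin_num by rewrite ge0_fin_numE ?isum_ge0.
by move: E => /(congr1 (fun z => z - isum per k)%E); rewrite !addeK.
Qed.

Lemma total_limited per V Vt : limited s V Vt -> mean_physical s V ->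
  total per Vt = total per V.
Proof.
move=> lim VP; have [_ H] := limited_physical eosP sP lim VP.
by apply: eq_isum => j; have [e1 e2] := H j; rewrite /cell_content e1 e2.
Qed.

Lemma total_combination per V W a b : 0 <= a -> 0 <= b ->
  mean_physical s V -> mean_physical s W ->
  (total per (a *: V + b *: W)%R = a%:E * total per V + b%:E * total per W)%E.
Proof.
move=> a0 b0 /cell_content_gt0 V0 /cell_content_gt0 W0.
rewrite /total -!isumZ//; [|by move=> j; apply: ltW..].
rewrite -isumD//; [|by move=> j; rewrite mulr_ge0// ltW..].
apply: eq_isum => j; rewrite /cell_content !averageD// !averageZ//.
by rewrite !linD !(linZ _ a) !(linZ _ b); ring.
Qed.

End Conservation.

(** * Half cells of the domain against cells of a period *)

Section Domain.
Variables (R : realType) (s : cdg R).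
Hypothesis sP : cdg_valid s.
Implicit Types (V : csol R) (bc : boundary) (a : int -> R).

Let dx0 : 0 < dx s. Proof. by case: sP => [[]]. Qed.
Let N0 : (0 < ncells s)%N. Proof. by case: sP => [[]]. Qed.
Let N := ncells s.

Definition period bc : option nat :=
  match bc with
  | Periodic => Some N
  | Reflective => Some (2 * N)%N
  | Vanishing => None
  end.

(** The composition of the reflections about both end points is the
    translation by twice the length of the domain. *)
Lemma boundary_has_period bc V :
  boundary_condition s bc V -> solution_has_period s (period bc) V.
Proof.
case: bc => //= -[r0 rN] j x.
have mK (u : state R) : mirror (mirror u) = u.
  by case: u => [[D m] E]; rewrite /mirror opprK.
have [e1 e2] := r0 j x.
have [f1 _] := rN (2 * 0 + 1 - j) (2 * ctrJ s 0 - x).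
have [_ f2] := rN (2 * 0 - j) (2 * ctrJ s 0 - x).
have jE1 : 2 * N%:Z + 1 - (2 * 0 + 1 - j) = j + (2 * N)%N%:Z by lia.
have jE2 : 2 * N%:Z - (2 * 0 - j) = j + (2 * N)%N%:Z by lia.
have xE : 2 * ctrJ s N%:Z - (2 * ctrJ s 0 - x) = x + (2 * N)%N%:Z%:~R * dx s.
  by rewrite /ctrJ /ctrI PoszM intrM; ring.
rewrite jE1 xE e1 mK in f1; rewrite jE2 xE e2 mK in f2.
by split.
Qed.

Lemma int_gt_pred (i j : int) : i%:~R - 1 < j%:~R :> R -> i <= j.
Proof.
rewrite leNgt => H; apply/negP => ji.
have : j%:~R <= (i - 1)%:~R :> R by rewrite ler_int; lia.
by rewrite intrB; lra.
Qed.

(** [q] is the position of the midpoint of the half cell relative to the center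
    of [I_j], in units of [dx]; the hypotheses put the midpoints with indices
    [m] and [n] next to the end points of the domain, one or three quarters of
    [dx] away from them.  By integrality, a half cell lies in the domain as
    soon as its midpoint does. *)
Lemma half_cells_inside (q : R) (m n : int) :
  3 / 4 <= m%:~R + q <= 5 / 4 ->
  N%:Z%:~R - 4^-1 <= n%:~R + q <= N%:Z%:~R + 4^-1 ->
  [set j : int | half_cell s (x0 s + (j%:~R + q) * dx s) `<=`
                 `]ctrJ s 0, ctrJ s N%:Z[] = [set j | m <= j <= n].
Proof.
move=> /andP[m1 m2] /andP[n1 n2]; rewrite /ctrJ /ctrI.
apply/seteqP; split=> j /=.
  move=> /(_ (x0 s + (j%:~R + q) * dx s)); rewrite /half_cell /= !in_itv /=.
  have -> : x0 s + (j%:~R + q) * dx s - dx s / 4 < x0 s + (j%:~R + q) * dx s <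
     x0 s + (j%:~R + q) * dx s + dx s / 4 by rewrite gtrBl ltrDl divr_gt0.
  move=> /(_ isT) /andP[h1 h2].
  have h3 : 2^-1 * dx s < (j%:~R + q) * dx s by lra.
  have h4 : (j%:~R + q) * dx s < (N%:Z%:~R + 2^-1) * dx s by lra.
  rewrite ltr_pM2r// in h3; rewrite ltr_pM2r// in h4.
  by apply/andP; split; apply: int_gt_pred; lra.
move=> /andP[mj jn] x; rewrite /half_cell /= !in_itv /= => /andP[h1 h2].
have k1 : m%:~R <= j%:~R :> R by rewrite ler_int.
have k2 : j%:~R <= n%:~R :> R by rewrite ler_int.
have k3 : 3 / 4 * dx s <= (j%:~R + q) * dx s by rewrite ler_pM2r//; lra.
have k4 : (j%:~R + q) * dx s <= (N%:Z%:~R + 4^-1) * dx s by rewrite ler_pM2r//; lra.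
by apply/andP; split; lra.
Qed.

(** The indices of the half cells inside the domain: [range_zero] for the right
    halves of the cells of the mesh [J], [range_one] for the three other
    kinds. *)
Definition range_one bc : set int :=
  if bc is Vanishing then setT else [set j : int | 1 <= j <= N%:Z].
Definition range_zero bc : set int :=
  if bc is Vanishing then setT else [set j : int | 0 <= j <= N%:Z - 1].

Lemma half_cells_of_domain bc :
  [/\ [set j | half_cell s (ctrI s j - dx s / 4) `<=` omega s bc] = range_one bc,
      [set j | half_cell s (ctrI s j + dx s / 4) `<=` omega s bc] = range_one bc,
      [set j | half_cell s (ctrJ s j - dx s / 4) `<=` omega s bc] = range_one bc &
      [set j | half_cell s (ctrJ s j + dx s / 4) `<=` omega s bc] = range_zero bc].
Proof.
have V (f : int -> R) : [set j | half_cell s (f j) `<=` setT] = setT.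
  by apply/seteqP; split.
have mid (f : int -> R) (q : R) (m n : int) :
    3 / 4 <= m%:~R + q <= 5 / 4 ->
    N%:Z%:~R - 4^-1 <= n%:~R + q <= N%:Z%:~R + 4^-1 ->
    (forall j, f j = x0 s + (j%:~R + q) * dx s) ->
    [set j : int | half_cell s (f j) `<=` `]ctrJ s 0, ctrJ s N%:Z[] =
    [set j | m <= j <= n].
  move=> h1 h2 fE; rewrite -(half_cells_inside h1 h2).
  by apply/seteqP; split=> j /=; rewrite fE.
have main : [/\ [set j | half_cell s (ctrI s j - dx s / 4) `<=` `]ctrJ s 0, ctrJ s N%:Z[] =
        [set j : int | 1 <= j <= N%:Z],
      [set j | half_cell s (ctrI s j + dx s / 4) `<=` `]ctrJ s 0, ctrJ s N%:Z[] =
        [set j : int | 1 <= j <= N%:Z],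
      [set j | half_cell s (ctrJ s j - dx s / 4) `<=` `]ctrJ s 0, ctrJ s N%:Z[] =
        [set j : int | 1 <= j <= N%:Z] &
      [set j | half_cell s (ctrJ s j + dx s / 4) `<=` `]ctrJ s 0, ctrJ s N%:Z[] =
        [set j : int | 0 <= j <= N%:Z - 1]].
  split.
  - by apply: (mid _ (- 4^-1)) => [||j]; [apply/andP; split; lra..|rewrite /ctrI; field].
  - by apply: (mid _ 4^-1) => [||j]; [apply/andP; split; lra..|rewrite /ctrI; field].
  - by apply: (mid _ 4^-1) => [||j]; [apply/andP; split; lra..|rewrite /ctrJ /ctrI; field].
  - apply: (mid _ (3 / 4)) => [||j]; [apply/andP; split; lra| |by rewrite /ctrJ /ctrI; field].
    by rewrite intrB; apply/andP; split; lra.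
by case: bc => //=; split; rewrite V.
Qed.

Definition domain_sum bc (aLI aRI aLJ aRJ : int -> R) : \bar R :=
  (\esum_(j in range_one bc) (aLI j)%:E + \esum_(j in range_one bc) (aRI j)%:E +
   (\esum_(j in range_one bc) (aLJ j)%:E + \esum_(j in range_zero bc) (aRJ j)%:E))%E.

Lemma half_norm_ge0 y (P : pstate R) : 0 <= half_norm s y P.
Proof.
apply: sumr_ge0 => a _; rewrite mulr_ge0//; first by apply/ltW/weight_gt0.
by case: (evalp _ _) => [[? ?] ?]; rewrite /l1norm !addr_ge0.
Qed.

Lemma total_norm bc V : (normI s bc V + normJ s bc V =
  (dx s / 2)%:E * domain_sum bc
    (fun j => half_norm s (ctrI s j - dx s / 4) (V.1 j))
    (fun j => half_norm s (ctrI s j + dx s / 4) (V.1 j))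
    (fun j => half_norm s (ctrJ s j - dx s / 4) (V.2 j))
    (fun j => half_norm s (ctrJ s j + dx s / 4) (V.2 j)))%E.
Proof.
rewrite /normI /normJ /mesh_norm /domain_sum.
have [-> -> -> ->] := half_cells_of_domain bc.
by rewrite -ge0_muleDr//; apply: adde_ge0; apply: esum_ge0 => j _;
  rewrite lee_fin half_norm_ge0.
Qed.

Definition multiplicity bc : R := if bc is Reflective then 2 else 1.

(** In the reflective case, the half cells of the second half of the period are
    the mirror images of those in the domain, left and right being exchanged.
    In the periodic case, the right halves of the cells of [J] are merely
    renumbered. *)
Lemma domain_sum_period bc (aLI aRI aLJ aRJ : int -> R) :
  (forall j, [/\ 0 <= aLI j, 0 <= aRI j, 0 <= aLJ j & 0 <= aRJ j]) ->
  has_period (period bc) aRJ ->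
  (bc = Reflective -> forall j,
    aLI (2 * N%:Z + 1 - j) = aRI j /\ aLJ (2 * N%:Z - j) = aRJ j) ->
  ((multiplicity bc)%:E * domain_sum bc aLI aRI aLJ aRJ =
   isum (period bc) (fun j => (aLI j + aRI j + (aLJ j + aRJ j))%R))%E.
Proof.
move=> a0 cRJ refl.
have LI0 j : 0 <= aLI j by have [] := a0 j.
have RI0 j : 0 <= aRI j by have [] := a0 j.
have LJ0 j : 0 <= aLJ j by have [] := a0 j.
have RJ0 j : 0 <= aRJ j by have [] := a0 j.
rewrite (isumD _ (fun j => addr_ge0 (LI0 j) (RI0 j)) (fun j => addr_ge0 (LJ0 j) (RJ0 j))).
rewrite (isumD _ LI0 RI0) (isumD _ LJ0 RJ0).
have zero_one (P : nat) : has_period (Some P) aRJ -> isum (Some P) aRJ =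
    \esum_(j in [set j : int | 0 <= j <= P%:Z - 1]) (aRJ j)%:E.
  move=> c; rewrite -(isum_pred c) /isum /=.
  rewrite [RHS](@reindex_esum _ _ _ [set j : int | 1 <= j <= P%:Z] _ (fun j => j - 1))//.
  split; first by move=> j /=; lia.
    by move=> i j _ _ /=; lia.
  by move=> j /= H; exists (j + 1); [rewrite /=|]; lia.
move: bc cRJ refl => [] /= cRJ refl; rewrite /domain_sum /=.
- by rewrite mul1e (zero_one _ cRJ).
- rewrite (zero_one _ cRJ) /isum /=.
  have {}refl := refl erefl.
  have NN : (2 * N)%N%:Z = 2 * N%:Z by lia.
  rewrite NN (esum_range_cat (n := N%:Z) (p := 2 * N%:Z) LI0); [|lia|lia].
  rewrite (esum_range_cat (n := N%:Z) (p := 2 * N%:Z) RI0); [|lia|lia].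
  rewrite (esum_range_cat (n := N%:Z) (p := 2 * N%:Z) LJ0); [|lia|lia].
  rewrite (esum_range_cat (n := N%:Z - 1) (p := 2 * N%:Z - 1) RJ0); [|lia|lia].
  have E1 : \esum_(j in [set j : int | N%:Z + 1 <= j <= 2 * N%:Z]) (aLI j)%:E =
      \esum_(j in [set j : int | 1 <= j <= N%:Z]) (aRI j)%:E.
    transitivity (\esum_(j in [set j : int | 1 <= j <= N%:Z]) (aLI (2 * N%:Z + 1 - j))%:E).
      by rewrite esum_range_reflect; congr esum; apply/seteqP; split=> j /=; lia.
    by apply: eq_esum => j _; have [-> _] := refl j.
  have E2 : \esum_(j in [set j : int | N%:Z + 1 <= j <= 2 * N%:Z]) (aRI j)%:E =
      \esum_(j in [set j : int | 1 <= j <= N%:Z]) (aLI j)%:E.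
    transitivity (\esum_(j in [set j : int | 1 <= j <= N%:Z]) (aRI (2 * N%:Z + 1 - j))%:E).
      by rewrite esum_range_reflect; congr esum; apply/seteqP; split=> j /=; lia.
    by apply: eq_esum => j _; have [<- _] := refl (2 * N%:Z + 1 - j); rewrite subKr.
  have E3 : \esum_(j in [set j : int | N%:Z + 1 <= j <= 2 * N%:Z]) (aLJ j)%:E =
      \esum_(j in [set j : int | 0 <= j <= N%:Z - 1]) (aRJ j)%:E.
    transitivity (\esum_(j in [set j : int | 0 <= j <= N%:Z - 1]) (aLJ (2 * N%:Z - j))%:E).
      by rewrite esum_range_reflect; congr esum; apply/seteqP; split=> j /=; lia.
    by apply: eq_esum => j _; have [_ ->] := refl j.
  have E4 : \esum_(j in [set j : int | N%:Z - 1 + 1 <= j <= 2 * N%:Z - 1]) (aRJ j)%:E =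
      \esum_(j in [set j : int | 1 <= j <= N%:Z]) (aLJ j)%:E.
    transitivity (\esum_(j in [set j : int | 1 <= j <= N%:Z]) (aRJ (2 * N%:Z - j))%:E).
      by rewrite esum_range_reflect; congr esum; apply/seteqP; split=> j /=; lia.
    by apply: eq_esum => j _; have [_ <-] := refl (2 * N%:Z - j); rewrite subKr.
  rewrite E1 E2 E3 E4.
  set A := (\esum_(j in _) (aLI j)%:E)%E; set B := (\esum_(j in _) (aRI j)%:E)%E.
  set C := (\esum_(j in _) (aLJ j)%:E)%E; set D := (\esum_(j in _) (aRJ j)%:E)%E.
  by rewrite mule_natl mule2n [(B + A)%E]addeC [(D + C)%E]addeC addeACA.
- by rewrite mul1e.
Qed.

End Domain.

(** * Norms against conserved totals *)

Section NormComparison.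
Variables (R : realType) (s : cdg R).
Hypothesis sP : cdg_valid s.
Implicit Types (V : csol R) (bc : boundary) (P : pstate R) (y : R).

Let dx0 : 0 < dx s. Proof. by case: sP => [[]]. Qed.
Let N0 : (0 < ncells s)%N. Proof. by case: sP => [[]]. Qed.
Let Y : state R := (1, 0, 1).

Lemma lobatto_mean_le_half_norm y P :
  `|lobatto_mean s (linp Y P) y| <= half_norm s y P.
Proof.
apply: (le_trans (ler_norm_sum _ _ _)); apply: ler_sum => a _.
have w0 : 0 <= weight (lobatto s) a by apply/ltW/weight_gt0.
rewrite normrM (ger0_norm w0) ler_wpM2l// horner_linp.
exact: lin_le_l1norm.
Qed.

Lemma half_norm_le_lobatto_mean y P :
  (forall a, (a < npts (lobatto s))%N ->
    physical (evalp P (halfnode s (lobatto s) y a))) ->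
  half_norm s y P + lobatto_mean s (linp (1, 0, 0) P) y <=
    2 * lobatto_mean s (linp Y P) y.
Proof.
move=> phys; rewrite /half_norm /lobatto_mean -big_split /= mulr_sumr.
apply: ler_sum => a _.
have w0 : 0 <= weight (lobatto s) a by apply/ltW/weight_gt0.
rewrite -mulrDr mulrCA ler_wpM2l// !horner_linp.
apply: le_trans (l1norm_lt (phys a (ltn_ord a))).
by rewrite lerD2l /lin /= !mul0r !addr0 mul1r.
Qed.

Lemma pint_reflect (f g : {poly R}) (z p q : R) :
  (forall x, g.[z - x] = f.[x]) -> p < q ->
  pint (z - q) (z - p) g = pint p q f.
Proof.
move=> gf pq; have [G GE] := poly_antiderivative g.
have E : (- (G \Po (z%:P - 'X)))^`() = g \Po (z%:P - 'X).
  by rewrite derivN deriv_comp derivB derivC derivX add0r mulrN1 opprK GE.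
have -> : pint p q f = pint p q ((- (G \Po (z%:P - 'X)))^`()).
  by congr Rintegral; apply/funext => x; rewrite E horner_comp !hornerE gf.
rewrite -GE /pint !integral_deriv_poly//; last by lra.
by rewrite !hornerN !horner_comp !hornerE opprK addrC.
Qed.

(** Stated for means rather than for [half_norm]: exact quadrature is insensitive
    to reflection. *)
Lemma lobatto_mean_reflect P P' (z y : R) :
  degree_le (deg s) P -> degree_le (deg s) P' ->
  (forall x, evalp P' (z - x) = mirror (evalp P x)) ->
  lobatto_mean s (linp Y P') (z - y) = lobatto_mean s (linp Y P) y.
Proof.
move=> dP dP' H; rewrite !lobatto_meanE ?size_linp//; congr (_ * _).
have -> : z - y - dx s / 4 = z - (y + dx s / 4) by ring.
have -> : z - y + dx s / 4 = z - (y - dx s / 4) by ring.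
apply: pint_reflect => [x|]; last by have := dx0; lra.
rewrite !horner_linp H /lin; case: (evalp P x) => [[D m] E] /=.
by rewrite !mul0r.
Qed.

(** A lower bound for the discrete norm which, unlike the means themselves, is
    nonnegative for the initial data, whose values at the nodes need not be
    physical. *)
Definition absolute_means V bc : \bar R := domain_sum s bc
  (fun j => `|left_mean s (ctrI s j) (V.1 j)|)
  (fun j => `|right_mean s (ctrI s j) (V.1 j)|)
  (fun j => `|left_mean s (ctrJ s j) (V.2 j)|)
  (fun j => `|right_mean s (ctrJ s j) (V.2 j)|).

Definition half_norms V bc : \bar R := domain_sum s bc
  (fun j => half_norm s (ctrI s j - dx s / 4) (V.1 j))
  (fun j => half_norm s (ctrI s j + dx s / 4) (V.1 j))
  (fun j => half_norm s (ctrJ s j - dx s / 4) (V.2 j))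
  (fun j => half_norm s (ctrJ s j + dx s / 4) (V.2 j)).

Lemma absolute_means_period bc V :
  (forall j, degree_le (deg s) (V.1 j) /\ degree_le (deg s) (V.2 j)) ->
  boundary_condition s bc V ->
  ((multiplicity R bc)%:E * absolute_means V bc = isum (period s bc)
    (fun j => (`|left_mean s (ctrI s j) (V.1 j)| +
               `|right_mean s (ctrI s j) (V.1 j)| +
              (`|left_mean s (ctrJ s j) (V.2 j)| +
               `|right_mean s (ctrJ s j) (V.2 j)|))%R))%E.
Proof.
move=> dV bcV; apply: domain_sum_period => //.
  have [_ _ _ c] := half_means_have_period (boundary_has_period sP bcV).
  exact: (has_period2 (fun x _ => `|x|) c c).
move=> bcR j; move: bcV; rewrite bcR => -[_ rN].
split; congr `|_|.
- have [d1 _] := dV j; have [d2 _] := dV (2 * (ncells s)%:Z + 1 - j).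
  rewrite /left_mean /right_mean.
  rewrite -(lobatto_mean_reflect _ d1 d2 (fun x => (rN j x).1)).
  congr lobatto_mean; rewrite /ctrJ /ctrI intrB intrD intrM.
  by field.
- have [_ d1] := dV j; have [_ d2] := dV (2 * (ncells s)%:Z - j).
  rewrite /left_mean /right_mean.
  rewrite -(lobatto_mean_reflect _ d1 d2 (fun x => (rN j x).2)).
  congr lobatto_mean; rewrite /ctrJ /ctrI intrB intrM.
  by field.
Qed.

Lemma domain_sum_le bc (a b c d a' b' c' d' : int -> R) :
  (forall j, [/\ a j <= a' j, b j <= b' j, c j <= c' j & d j <= d' j]) ->
  (domain_sum s bc a b c d <= domain_sum s bc a' b' c' d')%E.
Proof.
move=> H; rewrite /domain_sum.
by do !apply: leeD; apply: le_esum => j _; rewrite lee_fin; have [] := H j.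
Qed.

Lemma absolute_means_le_half_norms bc V : (absolute_means V bc <= half_norms V bc)%E.
Proof.
by apply: domain_sum_le => j; split; exact: lobatto_mean_le_half_norm.
Qed.

Lemma left_right_content V j :
  degree_le (deg s) (V.1 j) -> degree_le (deg s) (V.2 j) ->
  2 * cell_content s V j =
    left_mean s (ctrI s j) (V.1 j) + right_mean s (ctrI s j) (V.1 j) +
    (left_mean s (ctrJ s j) (V.2 j) + right_mean s (ctrJ s j) (V.2 j)).
Proof. by move=> d1 d2; rewrite /cell_content /left_mean /right_mean !average_linE//; field. Qed.

Lemma total_le_half_norms bc V : mean_physical s V -> boundary_condition s bc V ->
  (2%:E * total s (period s bc) V <= (multiplicity R bc)%:E * half_norms V bc)%E.
Proof.
move=> VP bcV.
have dV j : degree_le (deg s) (V.1 j) /\ degree_le (deg s) (V.2 j).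
  by have [] := VP j.
have m0 : 0 < multiplicity R bc by case: bc {bcV}.
apply: (@le_trans _ _ ((multiplicity R bc)%:E * absolute_means V bc)%E); last first.
  by rewrite lee_pmul2l// absolute_means_le_half_norms.
rewrite absolute_means_period// -isumZ//; last first.
  by move=> j; apply/ltW/cell_content_gt0.
apply: isum_le => j; have [d1 d2] := dV j.
rewrite left_right_content//.
by do ![apply: lerD]; exact: ler_norm.
Qed.

Lemma isum_period_lt_pinfty (P : nat) (a : int -> R) : (forall j, 0 <= a j) -> (isum (Some P) a < +oo)%E.
Proof.
move=> a0; elim: P => [|P IH]; rewrite /isum /=.
  rewrite (_ : [set j : int | _] = set0) ?esum_set0 ?ltry//.
  by apply/seteqP; split=> j //=; lia.
rewrite (esum_range_cat (n := P%:Z)) //; [|lia|lia].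
rewrite (_ : [set j : int | P%:Z + 1 <= j <= _] = [set P%:Z + 1]); last first.
  by apply/seteqP; split=> j /=; lia.
by rewrite esum_set1 ?lee_fin// lte_add_pinfty ?ltry.
Qed.

(** On the whole line this is where the finiteness of the discrete norm is
    used. *)
Lemma total_lt_pinfty bc V : mean_physical s V -> boundary_condition s bc V ->
  (total s (period s bc) V < +oo)%E.
Proof.
move=> VP bcV; have c0 j := ltW (cell_content_gt0 VP j).
case: bc bcV => bcV; [exact: isum_period_lt_pinfty..|].
have := total_le_half_norms VP bcV; rewrite mul1e.
have [nI nJ _ _] := bcV.
have : (normI s Vanishing V + normJ s Vanishing V < +oo)%E by rewrite lte_add_pinfty.
rewrite total_norm// -/(half_norms _ _) => fin le2; rewrite ltey; apply/eqP => E.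
move: le2 fin; rewrite E gt0_muley ?lte_fin// leye_eq => /eqP ->.
by rewrite gt0_muley ?lte_fin ?divr_gt0.
Qed.

(** The gap [d], here the mean density on the left half of the cell [I_1],
    makes the final inequality strict. *)
Lemma half_norms_le_total bc V : node_physical s V -> boundary_condition s bc V ->
  exists2 d : R, 0 < d &
  ((multiplicity R bc)%:E * (half_norms V bc + d%:E) <=
     4%:E * total s (period s bc) V)%E.
Proof.
move=> VP bcV; pose MP := node_mean_physical sP VP.
have dV j : degree_le (deg s) (V.1 j) /\ degree_le (deg s) (V.2 j).
  by have [] := VP j.
have m0 : 0 < multiplicity R bc by case: bc {bcV}.
pose mass j := lobatto_mean s (linp (1, 0, 0) (V.1 j)) (ctrI s j - dx s / 4).
have lobatto_gt0 c P ctr : causal c -> physical_on_nodes s ctr P ->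
    0 < lobatto_mean s (linp c P) (ctr - dx s / 4) /\
    0 < lobatto_mean s (linp c P) (ctr + dx s / 4).
  move=> cc pP; have [_ [_ [L1 _ _ _] _ _]] := sP.
  have L0 : (0 < npts (lobatto s))%N by rewrite (ltn_trans _ L1).
  have pl b : (b < npts (lobatto s))%N ->
      0 < (linp c P).[halfnode s (lobatto s) (ctr - dx s / 4) b].
    move=> bL; rewrite horner_linp; apply: (physicalP _).1 => //.
    by apply: pP; exact: lobatto_left_node.
  have pr b : (b < npts (lobatto s))%N ->
      0 < (linp c P).[halfnode s (lobatto s) (ctr + dx s / 4) b].
    move=> bL; rewrite horner_linp; apply: (physicalP _).1 => //.
    by apply: pP; exact: lobatto_right_node.
  split; [apply: lt_trans (lobatto_mean_gt sP L0 pl)|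
          apply: lt_trans (lobatto_mean_gt sP L0 pr)].
    by rewrite mulr_gt0 ?weight_gt0 ?pl.
  by rewrite mulr_gt0 ?weight_gt0 ?pr.
have mass0 j : 0 < mass j.
  by have [_ _ p _] := VP j; have [] := lobatto_gt0 _ _ _ (causal_mass R) p.
have upper P ctr : physical_on_nodes s ctr P ->
   [/\ half_norm s (ctr - dx s / 4) P +
         lobatto_mean s (linp (1, 0, 0) P) (ctr - dx s / 4) <= 2 * `|left_mean s ctr P|,
       half_norm s (ctr - dx s / 4) P <= 2 * `|left_mean s ctr P| &
       half_norm s (ctr + dx s / 4) P <= 2 * `|right_mean s ctr P|].
  move=> pP; have [m1 m2] := lobatto_gt0 _ _ _ (causal_mass R) pP.
  have h1 : half_norm s (ctr - dx s / 4) P +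
         lobatto_mean s (linp (1, 0, 0) P) (ctr - dx s / 4) <= 2 * left_mean s ctr P.
    apply: half_norm_le_lobatto_mean => a aL.
    by apply: pP; exact: lobatto_left_node.
  have h2 : half_norm s (ctr + dx s / 4) P +
         lobatto_mean s (linp (1, 0, 0) P) (ctr + dx s / 4) <= 2 * right_mean s ctr P.
    apply: half_norm_le_lobatto_mean => a aL.
    by apply: pP; exact: lobatto_right_node.
  have := ler_norm (left_mean s ctr P); have := ler_norm (right_mean s ctr P).
  by move=> n1 n2; split; lra.
exists (mass 1); first exact: mass0.
have le1 : (half_norms V bc + (mass 1)%:E <= 2%:E * absolute_means V bc)%E.
  have one : range_one s bc 1 by case: bc {bcV m0} => //=; lia.
  apply: (@le_trans _ _ (domain_sum s bc
      (fun j => half_norm s (ctrI s j - dx s / 4) (V.1 j) + mass j)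
      (fun j => half_norm s (ctrI s j + dx s / 4) (V.1 j))
      (fun j => half_norm s (ctrJ s j - dx s / 4) (V.2 j))
      (fun j => half_norm s (ctrJ s j + dx s / 4) (V.2 j)))).
    rewrite /half_norms /domain_sum; set A := (\esum_(j in _) _)%E.
    set B := (\esum_(j in _) _)%E; set C := (_ + _)%E.
    rewrite [leLHS]addeAC [(A + B + _)%E]addeAC.
    rewrite leeD2r// leeD2r//.
    have -> : \esum_(j in range_one s bc)
        (half_norm s (ctrI s j - dx s / 4) (V.1 j) + mass j)%:E =
        (A + \esum_(j in range_one s bc) (mass j)%:E)%E.
      rewrite /A -esumD; first by apply: eq_esum => j _; rewrite EFinD.
        by move=> j _; rewrite lee_fin half_norm_ge0.
      by move=> j _; rewrite lee_fin ltW.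
    rewrite leeD2l//; apply: esum_ge; exists [set 1] => //.
      by split=> // j ->.
    by rewrite fsbig_set1.
  apply: (@le_trans _ _ (domain_sum s bc
    (fun j => 2 * `|left_mean s (ctrI s j) (V.1 j)|)
    (fun j => 2 * `|right_mean s (ctrI s j) (V.1 j)|)
    (fun j => 2 * `|left_mean s (ctrJ s j) (V.2 j)|)
    (fun j => 2 * `|right_mean s (ctrJ s j) (V.2 j)|))).
    apply: domain_sum_le => j; have [_ _ p1 p2] := VP j.
    have [u1 _ u3] := upper _ _ p1; have [_ v2 v3] := upper _ _ p2.
    by split.
  rewrite /absolute_means /domain_sum !esumZ//.
  by rewrite -!ge0_muleDr// ?adde_ge0//; apply: esum_ge0 => j _; rewrite lee_fin.
apply: (@le_trans _ _ ((multiplicity R bc)%:E * (2%:E * absolute_means V bc))%E).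
  by rewrite lee_pmul2l.
rewrite muleCA absolute_means_period//.
have -> : (4%:E = 2%:E * 2%:E :> \bar R)%E by rewrite -EFinM -natrM.
rewrite -muleA lee_pmul2l// -isumZ//; last first.
  by move=> j; apply/ltW/cell_content_gt0.
apply: isum_le => j; have [d1 d2 p1 p2] := VP j.
rewrite left_right_content//.
have [g1 g2] := lobatto_gt0 _ _ _ (causal_mass_energy R) p1.
have [g3 g4] := lobatto_gt0 _ _ _ (causal_mass_energy R) p2.
by rewrite /left_mean /right_mean !gtr0_norm.
Qed.

End NormComparison.

(** * Time stepping *)

Section TimeStepping.
Variables (R : realType) (s : cdg R) (bc : boundary).
Hypothesis eosP : eos_assumptions (eos s).
Hypothesis sP : cdg_valid s.
Hypothesis cfl : tau s <= weight (lobatto s) 0%N * dx s / 2.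
Implicit Types (V W L : csol R) (r : R).

(** The invariants of the scheme after limiting; [r] is the value of the
    conserved total, and its finiteness is part of the invariant. *)
Definition limited_state r V : Prop :=
  [/\ node_physical s V, boundary_condition s bc V &
      total s (period s bc) V = r%:E].

Definition unlimited_state r V : Prop :=
  mean_physical s V /\ total s (period s bc) V = r%:E.

Lemma limited_state_of r V Vt :
  limited_bc s bc V Vt -> unlimited_state r V -> limited_state r Vt.
Proof.
move=> [lim _ bct] [VP Vr]; have [Vtp _] := limited_physical eosP sP lim VP.
by split=> //; rewrite (total_limited eosP sP _ lim VP).
Qed.

Lemma limited_is_unlimited r V : limited_state r V -> unlimited_state r V.
Proof. by move=> [Vp _ Vr]; split=> //; exact: node_mean_physical. Qed.

Lemma euler_state r V L (t : R) : limited_state r V -> is_cdg_operator s V L ->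
  0 < t <= tau s -> unlimited_state r (V + t *: L).
Proof.
move=> [Vp bcV Vr] op tt; split; first exact: (euler_mean_physical eosP sP cfl tt Vp op).
rewrite (total_conserved eosP sP cfl tt Vp op)//.
  exact: boundary_has_period.
by rewrite Vr ltry.
Qed.

Lemma combination_state r V W (a b : R) : 0 < a -> 0 < b -> a + b = 1 ->
  unlimited_state r V -> unlimited_state r W -> unlimited_state r (a *: V + b *: W).
Proof.
move=> a0 b0 ab [Vp Vr] [Wp Wr]; split; first exact: convex_mean_physical.
rewrite (total_combination sP _ (ltW a0) (ltW b0) Vp Wp) Vr Wr.
by rewrite -!EFinM -EFinD -mulrDl ab mul1r.
Qed.

Lemma rk_step_state r V V' : 0 < dt s <= tau s ->
  limited_state r V -> rk_step s bc V V' -> unlimited_state r V'.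
Proof.
move=> tt Vr [L0 [U1 [U1t [L1 [U2 [U2t [L2 [[op0 U1E lim1] [[op1 U2E lim2] [op2 ->]]]]]]]]]].
have Vu := limited_is_unlimited Vr.
have S1 : limited_state r U1t.
  by apply: (limited_state_of lim1); rewrite U1E; exact: euler_state.
have S2 : limited_state r U2t.
  apply: (limited_state_of lim2); rewrite U2E.
  by apply: combination_state => //; [lra|exact: euler_state].
by apply: combination_state => //; [lra|exact: euler_state].
Qed.

(** The two Euler steps have lengths [3 dt] and [12/11 dt]. *)
Lemma ms_step_state r V V3 V' : 0 < dt s -> 3 * dt s <= tau s ->
  limited_state r V -> limited_state r V3 -> ms_step s V V3 V' ->
  unlimited_state r V'.
Proof.
move=> t0 tt Vr V3r [L0 [L3 [op0 op3 ->]]].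
by apply: combination_state => //; [lra| |]; apply: euler_state => //; lra.
Qed.

End TimeStepping.

Local Open Scope ereal_scope.

Theorem theorem4p4 (R : realType) (s : cdg R) (bc : boundary)
    (meth : ssp_method) (U Ut : nat -> csol R) :
  eos_assumptions (eos s) ->
  cdg_valid s ->
  time_step_restriction s meth ->
  pcp_cdg_solution s bc meth U Ut ->
  forall n : nat,
    normI s bc (Ut n) + normJ s bc (Ut n) <
    2%:E * (normI s bc (U 0%N) + normJ s bc (U 0%N)).
Proof.
move=> eosP sP [dt0 dtle /andP[th0 thle]] [init lim step] n.
have [[dx0 tau0 _] _] := sP.
have dtE : dt s = (theta s * tau s)%R by rewrite /theta divfK// gt_eqF.
have cfl : (tau s <= weight (lobatto s) 0%N * dx s / 2)%R.
  rewrite -(ler_pM2l th0) -dtE.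
  by apply: le_trans dtle _; lra.
have U0P : mean_physical s (U 0%N).
  move=> j; have [d1 d2 a1 a2] := init j.
  by split=> //; exact: (admissible_physical eosP).
have [_ bc0 _] := lim 0%N.
have T0 : total s (period s bc) (U 0%N) \is a fin_num.
  rewrite ge0_fin_numE ?total_lt_pinfty//.
  by apply: isum_ge0 => j; apply/ltW/cell_content_gt0.
pose r := fine (total s (period s bc) (U 0%N)).
have Tr : total s (period s bc) (U 0%N) = r%:E by rewrite fineK.
have dt1 : (dt s <= tau s)%R.
  rewrite dtE ger_pMl//; apply: le_trans thle _.
  by case: (meth) => /=; lra.
have evolve k : unlimited_state s bc r (U k).
  elim/ltn_ind: k => -[|k] IH; first by split.
  have lims i : (i <= k)%N -> limited_state s bc r (Ut i).
    by move=> ik; apply: (limited_state_of eosP sP (lim i)); exact: IH.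
  have rk : rk_step s bc (Ut k) (U k.+1) -> unlimited_state s bc r (U k.+1).
    by apply: rk_step_state => //; [rewrite dt0|exact: lims].
  have := step k; rewrite /time_step; case: meth thle {step} => //= thle.
  case: ifP => // k3; apply: ms_step_state => //.
  - by rewrite dtE; nra.
  - exact: lims.
  - by apply: lims; rewrite leq_subr.
have [Vp bcV Vr] := limited_state_of eosP sP (lim n) (evolve n).
have [d d0 up] := half_norms_le_total sP Vp bcV.
have low := total_le_half_norms sP U0P bc0.
rewrite Vr in up; rewrite Tr in low.
rewrite !total_norm// -!/(half_norms _ _ _).
set m := multiplicity R bc in up low.
have m0 : (0 < m)%R by rewrite /m; case: (bc).
have chain : half_norms s (Ut n) bc + d%:E <= 2%:E * half_norms s (U 0%N) bc.
  rewrite -(@lee_pmul2l _ m%:E)//.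
  apply: le_trans up _; rewrite muleCA.
  have -> : 4%:E = 2%:E * 2%:E :> \bar R by rewrite -EFinM -natrM.
  by rewrite -muleA lee_pmul2l.
have h0 : 0 <= half_norms s (Ut n) bc.
  by do ![apply: adde_ge0]; apply: esum_ge0 => j _; rewrite lee_fin half_norm_ge0.
have fin : half_norms s (Ut n) bc \is a fin_num.
  rewrite ge0_fin_numE// ltey; apply/eqP => E; move: up.
  by rewrite E addye// gt0_muley ?lte_fin// -EFinM leye_eq.
rewrite muleCA lte_pmul2l ?lte_fin ?divr_gt0//.
apply: lt_le_trans chain.
by rewrite lteDl// lte_fin.
Qed.
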